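(* Let $s,t\ge 0$ be integers, $k=s+t$, $\Lambda=s\Lambda_0+t\Lambda_1$, and let $L>0$ be an integer. Then the Demazure crystals $B_{w_L^+}(\Lambda)$ and $B_{w_L^-}(\Lambda)$ are $$B_{w^+_L}(\Lambda)=\{(Y_1,\dots,Y_s,Y_{s+1},\dots,Y_k)\in B(\Lambda)\mid |Y_1|\le L,\ |Y_{s+1}|\le L-1\},$$ $$B_{w^-_L}(\Lambda)=\{(Y_1,\dots,Y_s,Y_{s+1},\dots,Y_k)\in B(\Lambda)\mid |Y_1|\le L-1,\ |Y_{s+1}|\le L\}.$$ Here, if $s=0$ the condition on $|Y_1|$ (first diagram of charge $0$) is omitted, and if $t=0$ the condition on $|Y_{s+1}|$ (first diagram of charge $1$) is omitted.
   Context: Extended Young diagrams. An extended Young diagram of charge $\gamma\in\{0,1\}$ is a sequence $Y=(y_j)_{j\ge0}$ of integers with $y_j\le y_{j+1}$ for all $j$ and $y_j=\gamma$ for all large $j$. Its width $|Y|$ is the least $L\ge 0$ with $y_L=\gamma$. Its concave corners are the points $(m,y_m)$ with $m=0$ or ($m\ge1$ and $y_{m-1}<y_m$); its convex corners are the points $(m,y_{m-1})$ with $m\ge1$ and $y_{m-1}<y_m$. A corner $(m,n)$ is $d$-diagonal with $d=m+n$; it is an $i$-corner ($i\in\{0,1\}$) if $d\equiv i \pmod 2$. Adding a node at a concave corner $(m,y_m)$ means replacing $y_m$ by $y_m-1$ (the corner becomes a convex corner on the same diagonal); removing a node is the inverse operation. The crystal $B(\Lambda)$. For $\Lambda=s\Lambda_0+t\Lambda_1$,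 $k=s+t$, let $\mathcal Y(\Lambda)$ be the set of $k$-tuples $\mathbf Y=(Y_1,\dots,Y_k)$ of extended Young diagrams with $Y_j$ of charge $0$ for $1\le j\le s$ and of charge $1$ for $s+1\le j\le k$. Order $\mathbb Z\times\{1,\dots,k\}$ by $(d,j)>(d',j')$ iff $d>d'$, or $d=d'$ and $j<j'$. The $i$-signature of $\mathbf Y$ is the sequence $(\varepsilon_1,\dots,\varepsilon_m)$ obtained by listing all $i$-corners of all $Y_j$ (a $d$-diagonal $i$-corner of $Y_j$ being indexed by $(d,j)$) in decreasing order of $(d,j)$ and writing $0$ for a concave corner and $1$ for a convex corner. Repeatedly delete adjacent pairs $(0,1)$ (adjacent after earlier deletions) until none is left; the remaining entries are called relevant and form a sequence $1\cdots1\,0\cdots0$. $\tilde f_i\mathbf Y$ is the tuple obtained by changing the leftmost relevant $0$ to $1$, i.e. adding a node at the corresponding concave corner ($\tilde f_i\mathbf Y=0$ if there is no relevant $0$); $\tilde e_i\mathbf Y$ is obtained by changing the rightmost relevant $1$ to $0$, i.e. removing the node at the corresponding convex corner ($\tilde e_i\mathbf Y=0$ if there is no relevant $1$). Let $\Phi\in\mathcal Y(\Lambda)$ be the tuple of empty (constant) diagrams. Then $B(\Lambda)=\{\tilde f_{i_1}\cdots\tilde f_{i_n}\Phi\mid n\ge0,\ i_j\in\{0,1\}\}\setminus\{0\}$; it is the crystal of the integrable highest weight $U_q(\widehat{sl}(2))$-module $V(\Lambda)$. Demazure crystals. Let $W$ be the Weyl group of $\widehat{sl}(2)$, generated by the simple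 reflections $r_0,r_1$ (infinite dihedral group), with Bruhat order $\prec$. For $L>0$ let $w_L^+=\cdots r_0r_1r_0$ and $w_L^-=\cdots r_1r_0r_1$ ($L$ factors each, rightmost factor $r_0$, resp. $r_1$). Kashiwara's Demazure crystals $B_w(\Lambda)\subset B(\Lambda)$, $w\in W$ (the crystals of the Demazure modules $E_w(\Lambda)$), are determined by $B_{\mathrm{id}}(\Lambda)=\{\Phi\}$ and, whenever $r_iw\prec w$, $B_w(\Lambda)=\{\tilde f_i^m b\mid m\ge0,\ b\in B_{r_iw}(\Lambda),\ \tilde e_ib=0\}\setminus\{0\}$. *)

(* Defs.v *)
(* MathComp, with sets as predicates from mathcomp.classical. *)
From Stdlib Require Import Relation_Operators.
From mathcomp Require Import all_boot all_order all_algebra.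
From mathcomp Require Import boolp classical_sets.

Set Implicit Arguments.
Unset Strict Implicit.
Unset Printing Implicit Defensive.

Import Order.TTheory GRing.Theory Num.Theory.
Local Open Scope ring_scope.
Local Open Scope classical_set_scope.

(** * Extended Young diagrams *)

Record eyd (g : int) := EYD {
  eyd_fun :> nat -> int;
  eyd_mono : forall j, eyd_fun j <= eyd_fun j.+1;
  eyd_stab : exists N, forall j, (N <= j)%N -> eyd_fun j = g }.

Fact eyd_width_subproof g (Y : eyd g) : exists L, Y L == g.
Proof. by have [N YN] := eyd_stab Y; exists N; rewrite YN. Qed.

Definition width g (Y : eyd g) : nat := ex_minn (eyd_width_subproof Y).

Definition concave (y : nat -> int) (m : nat) : bool :=
  (m == 0)%N || (y m.-1 < y m).

Definition convex (y : nat -> int) (m : nat) : bool :=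
  (0 < m)%N && (y m.-1 < y m).

(* To be total, node addition (removal) leaves the diagram unchanged when there
   is no concave (convex) corner of abscissa m. *)
Definition add_node_fun (y : nat -> int) (m : nat) : nat -> int :=
  fun j => if concave y m && (j == m) then y j - 1 else y j.

(* The convex corner (m, y_(m-1)) is the outer corner of the last node of
   column m-1, so it is the value at m-1 that changes. *)
Definition remove_node_fun (y : nat -> int) (m : nat) : nat -> int :=
  fun j => if convex y m && (j == m.-1) then y j + 1 else y j.

Section NodeFacts.
Variables (g : int) (Y : eyd g) (m : nat).

Fact add_node_mono j : add_node_fun Y m j <= add_node_fun Y m j.+1.
Proof.
rewrite /add_node_fun; have := eyd_mono Y j.
have [/orP cm /=|//] := boolP (concave Y m).
have [->|jm] := eqVneq j m; first by rewrite gtn_eqF // => /lerB /(_ ler01); rewrite subr0.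
have [jSm _|//] := eqVneq j.+1 m.
case: cm => [/eqP m0|]; first by rewrite m0 in jSm.
by move=> lt_m; rewrite lerBrDr lezD1; move: lt_m; rewrite -jSm.
Qed.

Fact add_node_stab :
  exists N, forall j, (N <= j)%N -> add_node_fun Y m j = g.
Proof.
have [N YN] := eyd_stab Y; exists (maxn N m.+1) => j.
rewrite geq_max => /andP[Nj mj].
by rewrite /add_node_fun gtn_eqF // andbF YN.
Qed.

Definition add_node : eyd g := EYD add_node_mono add_node_stab.

Fact remove_node_mono j : remove_node_fun Y m j <= remove_node_fun Y m j.+1.
Proof.
rewrite /remove_node_fun; have := eyd_mono Y j.
have [/andP[m0 cm] /=|//] := boolP (convex Y m).
have [jm _|jm] := eqVneq j m.-1.
  have jSm : j.+1 = m by rewrite jm prednK.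
  by rewrite -jm -jSm in cm *; rewrite gtn_eqF //= lezD1.
by case: eqVneq => // _ /le_trans; apply; rewrite lerDl.
Qed.

Fact remove_node_stab :
  exists N, forall j, (N <= j)%N -> remove_node_fun Y m j = g.
Proof.
have [N YN] := eyd_stab Y; exists (maxn N m.+1) => j.
rewrite geq_max => /andP[Nj mj].
rewrite /remove_node_fun gtn_eqF ?andbF ?YN //.
exact: leq_ltn_trans (leq_pred m) mj.
Qed.

Definition remove_node : eyd g := EYD remove_node_mono remove_node_stab.

End NodeFacts.

Fact empty_mono (g : int) (j : nat) : g <= g.
Proof. exact: lexx. Qed.

Fact empty_stab (g : int) : exists N, forall j, (N <= j)%N -> g = g.
Proof. by exists 0%N. Qed.

Definition empty_eyd (g : int) : eyd g :=
  @EYD g (fun _ => g) (empty_mono g) (empty_stab g).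

(** * Tuples of diagrams and the crystal B(s Lambda_0 + t Lambda_1) *)

(* Components are numbered from 0: Y_1, ..., Y_s are those of index < s. *)
Definition charge (s j : nat) : int := if (j < s)%N then 0 else 1.

Definition diagrams (s t : nat) : Type :=
  forall j : 'I_(s + t), eyd (charge s j).

Definition Phi (s t : nat) : diagrams s t := fun j => empty_eyd (charge s j).
Arguments Phi : clear implicits.

(* (j, m, b) is the corner of abscissa m of the j-th component which is concave
   if b = false and convex if b = true; b is thus the signature entry. *)
Definition corner (k : nat) : Type := ('I_k * nat * bool)%type.

Section Crystal.
Variables (s t : nat).
Implicit Types (Y : diagrams s t) (c : corner (s + t)) (i : 'I_2).

Definition is_corner Y c : bool :=
  let: (j, m, b) := c in if b then convex (Y j) m else concave (Y j) m.

Definition corner_diag Y c : int :=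
  let: (j, m, b) := c in m%:Z + (if b then Y j m.-1 else Y j m).

(* c precedes c' in the decreasing order of the pairs (d, j). Corners of one
   diagram lie on pairwise distinct diagonals, so there are no ties. *)
Definition corner_before Y : rel (corner (s + t)) := fun c c' =>
  (corner_diag Y c' < corner_diag Y c) ||
  (corner_diag Y c == corner_diag Y c') && (c.1.1 <= c'.1.1)%N.

(* Every corner of a diagram has abscissa at most its width, so this finite list
   contains all of them. *)
Definition candidates Y : seq (corner (s + t)) :=
  [seq (jm, b) | jm <- [seq (j, m) | j <- enum 'I_(s + t),
                                     m <- iota 0 (width (Y j)).+1],
                 b <- [:: false; true]].

Definition signature i Y : seq (corner (s + t)) :=
  sort (corner_before Y)
    [seq c <- candidates Y |
       is_corner Y c && (corner_diag Y c == (i : nat)%:Z %[mod 2])%Z].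

(* push c r prepends c to the already reduced word r and deletes the adjacent
   pair (0, 1) this may create. *)
Definition push c (r : seq (corner (s + t))) : seq (corner (s + t)) :=
  if r is c' :: r' then if ~~ c.2 && c'.2 then r' else c :: r else [:: c].

Definition relevant i Y : seq (corner (s + t)) :=
  foldr push [::] (signature i Y).

Definition add_at Y c : diagrams s t := fun j =>
  if j == c.1.1 then add_node (Y j) c.1.2 else Y j.

Definition remove_at Y c : diagrams s t := fun j =>
  if j == c.1.1 then remove_node (Y j) c.1.2 else Y j.

(* None stands for the element 0 of the crystal. *)
Definition ftilde i Y : option (diagrams s t) :=
  omap (add_at Y) (ohead [seq c <- relevant i Y | ~~ c.2]).

Definition etilde i Y : option (diagrams s t) :=
  omap (remove_at Y) (ohead (rev [seq c <- relevant i Y | c.2])).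

Definition crystal : set (diagrams s t) :=
  [set Y | exists l : seq 'I_2,
     foldr (fun i => obind (ftilde i)) (Some (Phi s t)) l = Some Y].

End Crystal.
Arguments crystal : clear implicits.

(** * The Weyl group of affine sl(2) and its Bruhat order *)

Definition cartan (i j : 'I_2) : int := if i == j then 2 else - 2.

(* Matrix, in the basis of simple roots, of
   r_i : alpha_j |-> alpha_j - a_ij alpha_i.  The Weyl group acts faithfully on
   the root lattice, hence is realised as a group of integer matrices. *)
Definition refl (i : 'I_2) : 'M[int]_2 :=
  \matrix_(k, j) ((k == j)%:R - (k == i)%:R * cartan i j).

Definition wprod (l : seq 'I_2) : 'M[int]_2 := \prod_(i <- l) refl i.

Definition weyl : set 'M[int]_2 := [set w | exists l, w = wprod l].

Definition wlength (w : 'M[int]_2) : nat :=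
  xget 0%N [set n | (exists2 l, size l = n & wprod l = w) /\
                    (forall l, wprod l = w -> (n <= size l)%N)].

Definition reflection (r : 'M[int]_2) : Prop :=
  exists2 u, weyl u & exists i, r = u * refl i * u^-1.

Definition bruhat_step (u v : 'M[int]_2) : Prop :=
  [/\ weyl u, exists2 r, reflection r & v = r * u
    & (wlength u < wlength v)%N].

(* The strict Bruhat order. *)
Definition bruhat : 'M[int]_2 -> 'M[int]_2 -> Prop :=
  clos_trans _ bruhat_step.

(* The alternating product of L simple reflections with rightmost factor r_i. *)
Fixpoint walt (i : 'I_2) (L : nat) : 'M[int]_2 :=
  if L is L'.+1 then walt (1 - i) L' * refl i else 1.

Definition wplus (L : nat) : 'M[int]_2 := walt 0 L.
Definition wminus (L : nat) : 'M[int]_2 := walt 1 L.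

(** * Demazure crystals *)

(* The defining equations B_1 = {Phi} and, when r_i w < w, B_w = set of the
   nonzero f_i^m b for b in B_(r_i w) with e_i b = 0.  In the infinite dihedral
   group every w <> 1 has exactly one such i and 1 has none, so the inductive
   family satisfies these equations and is the only one on W to do so. *)
Inductive demazure (s t : nat) : 'M[int]_2 -> diagrams s t -> Prop :=
| demazure_id : demazure 1 (Phi s t)
| demazure_string (i : 'I_2) (w : 'M[int]_2) (b b' : diagrams s t) (m : nat) :
    bruhat (refl i * w) w ->
    demazure (refl i * w) b ->
    etilde i b = None ->
    iter m (obind (ftilde i)) (Some b) = Some b' ->
    demazure w b'.
Arguments demazure : clear implicits.

(* Main.v *)
(* The crystal is identified with the set of tuples satisfying two conditions on
   the periodic family Y_(J + k) = Y_J + 2: it is nondecreasing in J, and for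
   every column m some J has Y_J(m + 1) < Y_(J+1)(m).  These conditions survive
   the operators f_i and e_i: if changing the node at a corner c broke them, the
   corner next to c in the i-signature would carry the same bit as c, and c would
   not have been the leftmost relevant 0 or the rightmost relevant 1.

   Let M be the largest width in such a tuple Y.  If M > 0, the conditions for
   column M - 1 force the last column of Y_1 (if it has width M, all components
   of charge 1 being narrower) or of Y_(s+1) (if it has width M, all components
   of charge 0 being narrower) to consist of one node, whose convex corner comes
   first in the signature of its colour; hence some e_i Y is nonzero.  So e_i Y = 0
   lowers the width bounds from w to r_i w, while f_i respects the bounds of w
   because widening a component of maximal width takes a node of the other
   colour.  Induction on L concludes. *)
From mathcomp Require Import all_boot all_order all_algebra.
From mathcomp Require Import boolp classical_sets.
From mathcomp Require Import zify ring.
From Stdlib Require Import Relation_Operators.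
Require Import Defs.

Set Implicit Arguments.
Unset Strict Implicit.
Unset Printing Implicit Defensive.

Import Order.TTheory GRing.Theory Num.Theory.
Local Open Scope ring_scope.

(** * Bracketing of words in the letters 0 and 1 *)

Section Bracketing.
Variables s t : nat.
Implicit Types (c x : corner (s + t)) (l u v : seq (corner (s + t))).

Definition is_one c := c.2.
Definition is_zero c := ~~ c.2.

Definition red l := foldr (@push s t) [::] l.

Lemma push_one c l : is_one c -> push c l = c :: l.
Proof. by rewrite /is_one /push => c1; case: l => // x l; rewrite c1. Qed.

Lemma push_zeros c l : all is_zero l -> push c l = c :: l.
Proof. by case: l => // x l /= /andP[/negbTE x0 _]; rewrite /push x0 andbF. Qed.

Lemma foldr_push_ones l u : all is_one l -> foldr (@push s t) u l = l ++ u.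
Proof.
by elim: l => //= x l IH /andP[x1 l1]; rewrite push_one // IH.
Qed.

(** A pair [x y] deleted inside [l] is also deleted in front of any word: pushing the 1 [y] never
    cancels, and the 0 [x] then removes it. *)
Lemma foldr_push_red l u : foldr (@push s t) u l = foldr (@push s t) u (red l).
Proof.
elim: l => //= x l ->; rewrite -/(red l).
case: (red l) => [|y r] //=; case: ifP => //= /andP[x0 y1].
by rewrite [push y _]push_one //= x0 y1.
Qed.

(** No 1 is left in [red u] for the zeros of [l] to cancel. *)
Lemma red_cat_zeros l u : all is_zero (red u) -> red (l ++ u) = red l ++ red u.
Proof.
move=> u0; rewrite /red foldr_cat -/(red u) -/(red l).
elim: l => //= x l IH; rewrite IH -/(red l).
case: (red l) => [|y r] //=; first by rewrite push_zeros.
by case: ifP.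
Qed.

Lemma red_cat_ones l u : all is_one (red l) -> red (l ++ u) = red l ++ red u.
Proof.
by move=> l1; rewrite {1}/red foldr_cat foldr_push_red foldr_push_ones.
Qed.

Lemma red_ones_zeros l : exists u v, [/\ red l = u ++ v, all is_one u & all is_zero v].
Proof.
elim: l => [|x l [u [v [/= -> u1 v0]]]]; first by exists [::], [::].
have [x1|x0] := boolP (is_one x).
  by exists (x :: u), v; rewrite push_one //= x1 u1.
case: u u1 => [|y u] /= => [_|/andP[y1 u1]].
  by exists [::], (x :: v); rewrite push_zeros //= v0 andbT.
by exists u, v; rewrite (negbTE x0 : x.2 = false) (y1 : y.2 = true).
Qed.

Lemma red_head_zero l c r : red l = c :: r -> ~~ is_one c -> all is_zero (red l).
Proof.
have [u [v [-> + v0]]] := red_ones_zeros l.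
by case: u => [|y u] //= /andP[y1 _] [<-]; rewrite y1.
Qed.

(* The same condition characterises the leftmost relevant 0 and the rightmost
   relevant 1, which makes the two operators mutually inverse. *)
Definition pivot l c := exists l1 l2,
  [/\ l = l1 ++ c :: l2, all is_one (red l1) & all is_zero (red l2)].

(** The 1 that [x] cancels lies in [red l1]. Otherwise [red l1] is empty and that 1 is [c] itself;
    then [r] is [red l2], made of zeros, with no entry of the bit of [c]. *)
Lemma pivot_cancel x y l c r : is_zero x -> red l = y :: r -> is_one y ->
  has (fun z => c.2 == z.2) r -> pivot l c -> pivot (x :: l) c.
Proof.
move=> x0 ry y1 r1 [l1 [l2 [el l11 l20]]]; exists (x :: l1), l2; split=> //.
  by rewrite el.
move: ry; rewrite el red_cat_ones //= -/(red l1) -/(red l2).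
case E: (red l1) l11 => [|z m] /= => [_|/andP[z1 m1] _].
  rewrite push_zeros // => -[cy rl2]; rewrite cy in r1.
  move: r1; rewrite -rl2 => /hasP[z]; move/(allP l20); rewrite /is_zero.
  by move: y1; rewrite /is_one => ->; case: (z.2).
by rewrite -/(is_zero x) x0 -/(is_one z) z1.
Qed.

Lemma filter_zero_ones l : all is_one l -> [seq x <- l | is_zero x] = [::].
Proof. by elim: l => //= x l IH /andP[x1 /IH ->]; rewrite /is_zero (x1 : x.2). Qed.

Lemma filter_one_zeros l : all is_zero l -> [seq x <- l | is_one x] = [::].
Proof. by elim: l => //= x l IH /andP[/negbTE x0 /IH ->]; rewrite /is_one x0. Qed.

(** A 0 put in front becomes the first relevant 0 if there is no relevant 1; otherwise it cancels
    the first relevant 1 and leaves the pivot in place by [pivot_cancel]. *)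
Lemma first_zero_pivot l c :
  ohead [seq x <- red l | is_zero x] = Some c <-> is_zero c /\ pivot l c.
Proof.
split; last first.
  case=> c0 [l1 [l2 [-> l11 l20]]]; rewrite red_cat_ones //= -/(red l2).
  by rewrite push_zeros // filter_cat filter_zero_ones //= c0.
elim: l => //= x l IH; rewrite -/(red l).
have [x1|x0] := boolP (is_one x).
  rewrite push_one //= /is_zero (x1 : x.2) /= => /IH[c0 [l1 [l2 [-> l11 l20]]]].
  split=> //; exists (x :: l1), l2; split=> //=.
  by rewrite push_one //= x1.
case E: (red l) => [|y r].
  by rewrite push_zeros //= [is_zero x]x0 => -[<-]; split=> //; exists [::], l; rewrite E.
have [y1|y0] := boolP (is_one y).
  rewrite /push (negbTE x0 : x.2 = false) (y1 : y.2) /= => h.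
  have /IH[c0 pl] : ohead [seq x <- red l | is_zero x] = Some c.
    by rewrite E /= /is_zero (y1 : y.2).
  split=> //; apply: pivot_cancel E y1 _ pl => //.
  have : c \in [seq x <- r | is_zero x] by case: filter h => //= z m [->]; rewrite mem_head.
  by rewrite mem_filter => /andP[_ cr]; apply/hasP; exists c.
have r0 := red_head_zero E y0.
rewrite -E push_zeros //= [is_zero x]x0 => -[<-]; split=> //.
by exists [::], l.
Qed.

Lemma last_one_pivot l c :
  ohead (rev [seq x <- red l | is_one x]) = Some c <-> is_one c /\ pivot l c.
Proof.
split; last first.
  case=> c0 [l1 [l2 [-> l11 l20]]]; rewrite red_cat_ones //= -/(red l2).
  rewrite push_one // filter_cat /= c0 (filter_one_zeros l20).
  by rewrite rev_cat.
elim: l => //= x l IH; rewrite -/(red l).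
have [x1|x0] := boolP (is_one x).
  rewrite push_one //= [is_one x]x1 rev_cons.
  case E: (rev [seq x <- red l | is_one x]) => [|y r] /=.
    move=> [<-]; split=> //; exists [::], l; split=> //.
    move/eqP: E; rewrite -size_eq0 size_rev size_filter -leqn0 leqNgt -has_count.
    by rewrite -all_predC.
  move=> h; have /IH[c0 [l1 [l2 [-> l11 l20]]]] :
    ohead (rev [seq x <- red l | is_one x]) = Some c by rewrite E.
  split=> //; exists (x :: l1), l2; split=> //=.
  by rewrite push_one //= [is_one x]x1.
case E: (red l) => [|y r].
  by rewrite push_zeros //= (negbTE x0).
have [y1|y0] := boolP (is_one y).
  rewrite /push (negbTE x0 : x.2 = false) (y1 : y.2) /= => h.
  have cr : c \in [seq x <- r | is_one x].
    by rewrite -mem_rev; case: rev h => //= z m [->]; rewrite mem_head.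
  have /IH[c0 pl] : ohead (rev [seq x <- red l | is_one x]) = Some c.
    by rewrite E /= [is_one y]y1 rev_cons; case: rev h.
  split=> //; apply: pivot_cancel E y1 _ pl => //.
  by move: cr; rewrite mem_filter => /andP[_ cr]; apply/hasP; exists c.
have r0 := red_head_zero E y0.
by rewrite -E push_zeros //= (negbTE x0) filter_one_zeros.
Qed.

End Bracketing.

(** * Corners of one boundary and the effect of a single node *)

Section Corners.
Implicit Types (y : nat -> int) (m n : nat) (b : bool) (d : int).

Definition corner_at y m b : bool := if b then convex y m else concave y m.
Definition diag_at y m b : int := m%:Z + (if b then y m.-1 else y m).

Definition incr y := forall m, y m <= y m.+1.

Lemma incr_le y m n : incr y -> (m <= n)%N -> y m <= y n.
Proof.
move=> yi /subnK <-; elim: (n - m)%N => [|p IH]; first by rewrite add0n.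
by rewrite addSn (le_trans IH).
Qed.

Lemma corner_at_shift y e m b :
  corner_at (fun n => y n + e) m b = corner_at y m b.
Proof. by case: b; rewrite /= /convex /concave ltrD2r. Qed.

Lemma diag_at_shift y e m b : diag_at (fun n => y n + e) m b = diag_at y m b + e.
Proof. by case: b; rewrite /diag_at addrA. Qed.

(** Both coordinates weakly increase along the boundary, so diagonals strictly increase from one
    corner to the next. *)
Lemma corner_at_uniq y m b m' b' : incr y ->
  corner_at y m b -> corner_at y m' b' -> diag_at y m b = diag_at y m' b' ->
  m = m' /\ b = b'.
Proof.
move=> yi.
wlog: m b m' b' / (m <= m')%N => [W|].
  have [mm'|/ltnW mm'] := leqP m m'; first exact: W.
  by move=> c c' d; have [] := W _ _ _ _ mm' c' c (esym d).
move=> mm'; rewrite /diag_at /corner_at /convex /concave.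
have h1 := incr_le yi mm'.
have h2 : y m.-1 <= y m'.-1 by apply: incr_le => //; lia.
have [<-{h1 h2}|ne] := eqVneq m m'; first by case: b; case: b'; lia.
have : y m <= y m'.-1 by apply: incr_le => //; lia.
case: b; case: b'; lia.
Qed.

(* On this diagonal the boundary of [y] is in the middle of a horizontal side. *)
Lemma no_corner_flat y n m b : incr y -> y n = y n.+1 ->
  corner_at y m b -> diag_at y m b <> n.+1%:Z + y n.
Proof.
move=> yi yn; have [mn|mn] := leqP m n.
  have := incr_le yi mn; have : y m.-1 <= y n by apply: incr_le => //; lia.
  by case: b; rewrite /diag_at /=; lia.
have [->|mn1] := eqVneq m n.+1.
  by case: b; rewrite /= /convex /concave /= yn ltxx.
have /(incr_le yi) : (n.+1 <= m)%N by [].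
have : y n.+1 <= y m.-1 by apply: incr_le => //; lia.
by case: b; rewrite /diag_at /=; lia.
Qed.

(** From column [n] on, the boundary is the constant [g], so a corner has abscissa at most [n] and
    ordinate at most [g]. *)
Lemma corner_bound y n m b g : incr y -> y n = g -> (forall j, y j <= g) ->
  corner_at y m b -> diag_at y m b <= n%:Z + g.
Proof.
move=> yi yn yg; have [mn|mn] := leqP m n.
  have := yg m; have := yg m.-1; case: b; rewrite /diag_at; lia.
have : y n <= y m.-1 by apply: incr_le => //; lia.
have := yg m; have := yg m.-1; case: b; rewrite /= /convex /concave; lia.
Qed.

Lemma add_node_funE y m n : concave y m ->
  add_node_fun y m n = if n == m then y n - 1 else y n.
Proof. by rewrite /add_node_fun => ->. Qed.

Lemma remove_node_funE y m n : convex y m.+1 ->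
  remove_node_fun y m.+1 n = if n == m then y n + 1 else y n.
Proof. by rewrite /remove_node_fun => ->. Qed.

(* Adding a node on diagonal [d] affects corners on the diagonals [d - 1],
   [d] and [d + 1] only. *)
Lemma corner_at_add y m n b e : incr y -> concave y m -> (n, b) != (m, false) ->
  corner_at y n b -> diag_at y n b = diag_at y m false + e *+ 2 ->
  corner_at (add_node_fun y m) n b /\
  diag_at (add_node_fun y m) n b = diag_at y n b.
Proof.
move=> yi cm nm.
rewrite /diag_at /corner_at /convex /concave !(add_node_funE _ cm).
have := yi m.
case: b nm => nm; last first.
  have nm' : n != m by apply: contraNneq nm => ->.
  rewrite (negbTE nm'); case: n nm nm' => [|n] _ nm' //=.
  by case: eqVneq => [->|//]; lia.
case: n nm => [|n] _ //=; case: (eqVneq n m) => [->|nm]; first by case: eqP; lia.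
case: (eqVneq n.+1 m) => [<-|//]; lia.
Qed.

Lemma corner_at_addV y m n b e : incr y -> concave y m -> (n, b) != (m.+1, true) ->
  corner_at (add_node_fun y m) n b ->
  diag_at (add_node_fun y m) n b = diag_at y m false + e *+ 2 ->
  [/\ corner_at y n b, diag_at (add_node_fun y m) n b = diag_at y n b &
      (n, b) != (m, false)].
Proof.
move=> yi cm nm.
rewrite /diag_at /corner_at /convex /concave !(add_node_funE _ cm).
have := yi m.
case: b nm => nm; last first.
  case: (eqVneq n m) => [->|nm']; first by move=> *; exfalso; lia.
  rewrite xpair_eqE (negbTE nm'); case: n nm nm' => [|n] _ nm' //=.
  by case: eqVneq => [->|_ _ cn _] *; split=> //; lia.
rewrite xpair_eqE andbF; case: n nm => [|n] nm //=.
case: (eqVneq n m) => [nm'|nm']; first by rewrite nm' eqxx in nm.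
case: (eqVneq n.+1 m) => [<-|_ _ cn _]; split=> //; lia.
Qed.

Lemma corner_at_new y m : concave y m -> incr y ->
  corner_at (add_node_fun y m) m.+1 true /\
  diag_at (add_node_fun y m) m.+1 true = diag_at y m false.
Proof.
move=> cm yi; rewrite /corner_at /diag_at /convex /= !add_node_funE // eqxx.
by have := yi m; case: eqP; lia.
Qed.

Lemma corner_at_removed y m : convex y m.+1 -> incr y ->
  corner_at (remove_node_fun y m.+1) m false /\
  diag_at (remove_node_fun y m.+1) m false = diag_at y m.+1 true.
Proof.
move=> cm yi; rewrite /corner_at /diag_at /concave /= !remove_node_funE // eqxx.
case: m cm => [|m] cm; first by split=> //; lia.
by have := yi m; rewrite /=; case: eqP; lia.
Qed.

Lemma remove_node_funK y m : convex y m.+1 -> incr y ->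
  add_node_fun (remove_node_fun y m.+1) m =1 y.
Proof.
move=> cm yi n; have [/= c _] := corner_at_removed cm yi.
rewrite add_node_funE // remove_node_funE //; case: eqP; lia.
Qed.

End Corners.

(* The second condition singles out the connected component of the empty tuple. *)
Definition cylindric (z : nat -> nat -> int) : Prop :=
  (forall J m, z J m <= z J.+1 m) /\
  (forall m, exists J, z J m.+1 < z J.+1 m).

(** * Stability of the cylindric conditions under a change of one node *)

Section Cylindric.
Variables (k : nat) (z : nat -> nat -> int).
Hypotheses (k0 : (0 < k)%N) (zi : forall J, incr (z J)).
Hypothesis (zper : forall J m, z (J + k)%N m = z J m + 2).

(** Inequalities between neighbouring rows may thus be checked at one representative of each class
    of rows. *)
Lemma shift_mod J J' : J = J' %[mod k] ->
  exists e, forall i m, z (J + i)%N m = z (J' + i)%N m + e.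
Proof.
have zq q i m : z (i + q * k)%N m = z i m + q%:Z *+ 2.
  elim: q => [|q IH]; first by rewrite mul0n addn0 addr0.
  by rewrite mulSn addnCA addnC zper IH; lia.
wlog: J J' / (J <= J')%N => [W|JJ' /eqP].
  have [JJ'|/ltnW JJ'] := leqP J J'; first exact: W.
  by move=> /esym/(W _ _ JJ')[e h]; exists (- e) => i m; rewrite h addrK.
rewrite eq_sym eqn_mod_dvd // => /dvdnP[q eq].
exists (- (q%:Z *+ 2)) => i m.
by rewrite (_ : (J' + i = (J + i) + q * k)%N) ?zq ?addrK //; lia.
Qed.

(** The last hypothesis says that, going back at most [k] rows from [J], the first row with a corner
    on the diagonal of the new node has no concave corner there. Either condition can fail only in
    column [m]; a failure yields such a concave corner, or else keeps [k] rows constant against the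
    period. *)
Lemma cylindric_add z' J m : cylindric z -> (k <= J)%N -> concave (z J) m ->
  (forall J' n, z' J' n =
     z J' n - if (J' == J %[mod k])%N && (n == m) then 1 else 0) ->
  (forall r, (0 < r <= k)%N ->
     (forall r' n b, (0 < r' < r)%N -> corner_at (z (J - r')%N) n b ->
        diag_at (z (J - r')%N) n b <> diag_at (z J) m false) ->
     forall n, concave (z (J - r)%N) n ->
        diag_at (z (J - r)%N) n false <> diag_at (z J) m false) ->
  cylindric z'.
Proof.
move=> [z1 z2] kJ cm z'E H; have J0 := leq_trans k0 kJ.
have JE : ((J - 1).+1 = J)%N by lia.
have z1J n : z (J - 1)%N n <= z J n by have := z1 (J - 1)%N n; rewrite JE.
split=> [J' n|n].
  rewrite !z'E; have [nm|_] := eqVneq n m; last by rewrite !andbF !subr0.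
  rewrite nm !andbT; case: (boolP (J'.+1 == _ %[mod k])) => [J'J|_]; last first.
    by have := z1 J' m; case: ifP; lia.
  (* If the values agreed, row [J - 1] would have a concave corner at the same point as row [J],
     against [H] with [r = 1]. *)
  have zlt : z (J - 1)%N m < z J m.
    rewrite lt_neqAle z1J andbT; apply/eqP => e.
    apply: (H 1%N _ _ m); rewrite ?k0 //; first by lia.
      case/orP: cm => [m0|lt]; apply/orP; [by left|right]; rewrite e.
      exact: le_lt_trans lt.
    by rewrite /diag_at e.
  have /shift_mod[e he] : J' = J - 1 %[mod k].
    by apply/eqP; rewrite -(eqn_modDr 1) !addn1 JE.
  have := he 0%N m; have := he 1%N m; rewrite !addn1 !addn0 JE.
  by case: ifP; lia.
have [nm|nm] := eqVneq n m; last first.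
  have [J' hJ'] := z2 n; exists J'; rewrite !z'E (negbTE nm) andbF.
  by case: ifP; lia.
rewrite {}nm {n}; apply: contrapT => hn.
have {}hn J' : z J'.+1 m <= z J' m.+1 + if (J'.+1 == J %[mod k])%N then 1 else 0.
  rewrite leNgt; apply/negP => h; apply: hn; exists J'; rewrite !z'E eqxx andbT.
  by rewrite (gtn_eqF (ltnSn m)) andbF; move: h; case: ifP; lia.
set v := z J m.
(* The old strict inequality in column [m] is destroyed by the node, so it sits between rows
   congruent to [J - 1] and [J] and has difference exactly 1. *)
have [K hK] := z2 m; have := hn K.
case: (boolP (K.+1 == _ %[mod k])) => [KJ hK'|_]; last by lia.
have e1 : z (J - 1)%N m.+1 = v - 1.
  have /shift_mod[e he] : K = J - 1 %[mod k].
    by apply/eqP; rewrite -(eqn_modDr 1) !addn1 JE.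
  have := he 0%N m.+1; have := he 1%N m; rewrite !addn1 !addn0 JE.
  by rewrite /v; lia.
(* Going back from [J], every row equals [v - 1] in columns [m] and [m + 1]: a smaller value in
   column [m] would give a concave corner at [m + 1] on the diagonal of the new node, with only flat
   rows in between. *)
have flat r : (0 < r <= k)%N ->
    z (J - r)%N m.+1 = v - 1 /\ (forall r', (0 < r' <= r)%N -> z (J - r')%N m = v - 1
       /\ z (J - r')%N m.+1 = v - 1).
  elim: r => // r IH rk.
  have er : z (J - r.+1)%N m.+1 = v - 1 /\
     (forall r', (0 < r' <= r)%N -> z (J - r')%N m = v - 1 /\ z (J - r')%N m.+1 = v - 1).
    have [r0|r0] := posnP r; first by rewrite r0; split=> // r'; lia.
    have [|h1 h2] := IH; first by lia.
    split=> //; have [|h3 h4] := h2 r; first by lia.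
    have JrE : ((J - r.+1).+1 = J - r)%N by lia.
    have := z1 (J - r.+1)%N m.+1; have := hn (J - r.+1)%N; rewrite JrE.
    suff -> : (J - r == J %[mod k])%N = false by lia.
    rewrite eq_sym eqn_mod_dvd ?subKn; try lia.
    by apply/negbTE/negP => /dvdn_leq; lia.
  have [er1 er2] := er; split=> // r' /andP[r'0].
  rewrite leq_eqVlt ltnS => /orP[/eqP->|r'r]; last by apply: er2; rewrite r'0.
  split=> //; apply/eqP; rewrite eq_le -{1}er1 zi /= leNgt; apply/negP => lt.
  apply: (H r.+1 rk _ m.+1); last by rewrite /diag_at er1 /v; lia.
    move=> {r' r'0} r' n b r'r cn.
    have [|f1 f2] := er2 r'; first by lia.
    have := no_corner_flat (n := m) (zi _) _ cn; rewrite f1 f2 => /(_ erefl).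
    by rewrite /diag_at /v; lia.
  by rewrite /concave /= er1.
(* After a full turn back the value should be [v - 2], not [v - 1]. *)
have [|_ /(_ k)[|f1 _]] := flat k; try by rewrite k0 leqnn.
have := zper (J - k)%N m; rewrite subnK // f1 /v; lia.
Qed.

(** Mirror image of [cylindric_add]: the rows after [J] are inspected, and a failure of the second
    condition, possible only in column [m - 1], propagates the value [z J m + 1] through a full
    turn, where the period demands [z J m + 2]. *)
Lemma cylindric_remove z' J m : cylindric z -> convex (z J) m.+1 ->
  (forall J' n, z' J' n =
     z J' n + if (J' == J %[mod k])%N && (n == m) then 1 else 0) ->
  (forall r, (0 < r <= k)%N ->
     (forall r' n b, (0 < r' < r)%N -> corner_at (z (J + r')%N) n b ->
        diag_at (z (J + r')%N) n b <> diag_at (z J) m.+1 true) ->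
     forall n, convex (z (J + r)%N) n ->
        diag_at (z (J + r)%N) n true <> diag_at (z J) m.+1 true) ->
  cylindric z'.
Proof.
move=> [z1 z2] cm z'E H.
split=> [J' n|n].
  rewrite !z'E; have [nm|_] := eqVneq n m; last by rewrite !andbF !addr0.
  rewrite nm !andbT; case: (boolP (J' == _ %[mod k])) => [/eqP J'J|_]; last first.
    by have := z1 J' m; case: ifP; lia.
  have zlt : z J m < z J.+1 m.
    rewrite lt_neqAle z1 andbT; apply/eqP => e.
    apply: (H 1%N _ _ m.+1); rewrite ?addn1 ?k0 //; first by lia.
      move: cm; rewrite /convex /= e => /lt_le_trans; exact.
    by rewrite /diag_at /= e.
  have [e he] := shift_mod J'J.
  have := he 0%N m; have := he 1%N m; rewrite !addn1 !addn0.
  by case: ifP; lia.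
have [nm|nm] := eqVneq n.+1 m; last first.
  have [J' hJ'] := z2 n; exists J'; rewrite !z'E (negbTE nm) andbF.
  by case: ifP; lia.
apply: contrapT => hn.
have {}hn J' : z J'.+1 n <= z J' m + if (J' == J %[mod k])%N then 1 else 0.
  rewrite leNgt; apply/negP => h; apply: hn; exists J'; rewrite !z'E nm eqxx andbT.
  by rewrite -nm (ltn_eqF (ltnSn n)) andbF nm; move: h; case: ifP; lia.
set u := z J m.
have [K hK] := z2 n; have := hn K; rewrite nm in hK.
case: (boolP (K == _ %[mod k])) => [/eqP KJ hK'|_]; last by lia.
have e1 : z (J + 1)%N n = u + 1.
  have [e he] := shift_mod KJ.
  have := he 0%N m; have := he 1%N n; rewrite !addn1 !addn0.
  by rewrite /u; lia.
have flat r : (0 < r <= k)%N ->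
    z (J + r)%N n = u + 1 /\ (forall r', (0 < r' <= r)%N -> z (J + r')%N n = u + 1
       /\ z (J + r')%N m = u + 1).
  elim: r => // r IH rk.
  have er : z (J + r.+1)%N n = u + 1 /\
     (forall r', (0 < r' <= r)%N -> z (J + r')%N n = u + 1 /\ z (J + r')%N m = u + 1).
    have [r0|r0] := posnP r; first by rewrite r0; split=> // r'; lia.
    have [|h1 h2] := IH; first by lia.
    split=> //; have [|h3 h4] := h2 r; first by lia.
    have := z1 (J + r)%N n; have := hn (J + r)%N; rewrite addnS.
    suff -> : (J + r == J %[mod k])%N = false by lia.
    rewrite -{2}[J]addn0 eqn_modDl mod0n.
    by apply/negbTE/negP => /dvdn_leq; lia.
  have [er1 er2] := er; split=> // r' /andP[r'0].
  rewrite leq_eqVlt ltnS => /orP[/eqP->|r'r]; last by apply: er2; rewrite r'0.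
  split=> //; apply/eqP; rewrite eq_le -{2}er1 -nm zi andbT /= leNgt; apply/negP => lt.
  apply: (H r.+1 rk _ n.+1); last by rewrite /diag_at /= er1 /u; lia.
    move=> {r' r'0} r' n' b r'r cn.
    have [|f1 f2] := er2 r'; first by lia.
    have := no_corner_flat (n := n) (zi _) _ cn; rewrite nm f1 f2 => /(_ erefl).
    by rewrite /diag_at /= /u; lia.
  by rewrite /convex /= er1.
have [|_ /(_ k)[|_ f1]] := flat k; try by rewrite k0 leqnn.
have := zper J m; rewrite f1 /u; lia.
Qed.

End Cylindric.

(** * Widths and equality of diagrams *)

Section Diagrams.
Variable g : int.
Implicit Type Y : eyd g.

Lemma eyd_le Y n : Y n <= g.
Proof.
have [N YN] := eyd_stab Y; have := YN (maxn N n); rewrite leq_maxl => /(_ isT) {2}<-.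
by apply: incr_le (leq_maxr _ _); apply: eyd_mono.
Qed.

Lemma width_le Y n : (width Y <= n)%N <-> Y n = g.
Proof.
rewrite /width; case: ex_minnP => w /eqP Yw wmin; split=> [wn|Yn].
  by apply/eqP; rewrite eq_le eyd_le /= -[X in X <= _]Yw incr_le //; apply: eyd_mono.
exact/wmin/eqP.
Qed.

Lemma eyd_eq Y Y' : Y =1 Y' -> Y = Y'.
Proof.
case: Y Y' => [y m1 s1] [y' m2 s2] /= /funext E; subst y'.
by congr EYD; apply: Prop_irrelevance.
Qed.

End Diagrams.

Lemma modz2P (d : int) (i : 'I_2) :
  reflect (exists e : int, d = i%:Z + e *+ 2) (d == (i : nat)%:Z %[mod 2])%Z.
Proof.
rewrite eqz_mod_dvd; apply: (iffP dvdzP) => -[e he]; exists e; lia.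
Qed.

(** * The signature as a strictly decreasing list of integers *)

Section Signature.
Variables s t : nat.
Implicit Types (Y : diagrams s t) (c x : corner (s + t)) (i : 'I_2).

Definition gtz : rel int := fun a b => b < a.

(* On corners of one colour this is injective, decreases along the signature,
   and takes values in a single class modulo 2. *)
Definition position Y c : int :=
  corner_diag Y c * (s + t)%:Z - (c.1.1 : nat)%:Z *+ 2.

Definition icorner i Y c : bool :=
  is_corner Y c && (corner_diag Y c == (i : nat)%:Z %[mod 2])%Z.

Lemma diagrams_incr Y j : incr (Y j).
Proof. exact: eyd_mono. Qed.

Lemma is_cornerE Y j m b : is_corner Y (j, m, b) = corner_at (Y j) m b.
Proof. by []. Qed.

Lemma corner_diagE Y j m b : corner_diag Y (j, m, b) = diag_at (Y j) m b.
Proof. by []. Qed.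

Lemma mem_candidates Y c : is_corner Y c -> c \in candidates Y.
Proof.
case: c => [[j m] b] cm; apply/allpairsP; exists ((j, m), b); split=> //; last by case: b cm.
apply/allpairsPdep; exists j, m; split=> //; first exact: mem_enum.
rewrite mem_iota /= add0n ltnS leqNgt; apply/negP => wm.
have /(width_le _ _) e1 := leqnn (width (Y j)).
have e2 : Y j m.-1 = charge s j by apply/width_le; lia.
have e3 : Y j m = charge s j by apply/width_le; lia.
by move: cm; rewrite /is_corner /convex /concave e2 e3 ltxx; case: b; lia.
Qed.

Lemma mem_signature i Y c : (c \in signature i Y) = icorner i Y c.
Proof.
rewrite mem_sort mem_filter -/(icorner i Y c).
by have [/andP[/mem_candidates->]|] := boolP (icorner i Y c).
Qed.

(** Diagonals of one colour differ by multiples of 2, scaled by [s + t] in [position]; two indices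
    differ by less than [s + t], so diagonal and index are both recovered. *)
Lemma position_inj i Y c x :
  icorner i Y c -> icorner i Y x -> position Y c = position Y x -> c = x.
Proof.
move: c x => [[j m] b] [[j' m'] b'] /andP[c1 /modz2P[e he]] /andP[c2 /modz2P[e' he']].
rewrite /position he he' /= => E.
have jk := ltn_ord j; have jk' := ltn_ord j'.
have ee : e = e' by nia.
have jj : j = j' by apply: val_inj => /=; move: E; rewrite ee; lia.
move: c2 he'; rewrite -jj -ee is_cornerE -he !corner_diagE => c2 he'.
by have [-> ->] := corner_at_uniq (@diagrams_incr Y j) c1 c2 (esym he').
Qed.

Lemma corner_before_position i Y c x : icorner i Y c -> icorner i Y x -> c != x ->
  corner_before Y c x -> position Y x < position Y c.
Proof.
move=> ic ix cx cb; rewrite lt_neqAle; apply/andP; split.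
  by apply: contra cx => /eqP/(position_inj ix ic)->.
move: cb ic ix; rewrite /corner_before /position /icorner.
case/orP=> [lt|/andP[/eqP->] le _ _]; last by lia.
move=> /andP[_ /modz2P[e he]] /andP[_ /modz2P[e' he']].
have jk := ltn_ord c.1.1; have jk' := ltn_ord x.1.1.
move: lt; rewrite he he'; nia.
Qed.

Lemma uniq_signature i Y : uniq (signature i Y).
Proof.
rewrite sort_uniq filter_uniq // allpairs_uniq //; last by move=> [? ?] [? ?].
apply: allpairs_uniq_dep => [|j _|]; [exact: enum_uniq|exact: iota_uniq|].
by move=> [? ?] [? ?] _ _ [-> ->].
Qed.

Lemma sorted_signature i Y : sorted gtz [seq position Y c | c <- signature i Y].
Proof.
rewrite sorted_map.
have tot : total (corner_before Y).
  by move=> c x; rewrite /corner_before; case: ltgtP => //= _; apply: leq_total.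
have tr : transitive (corner_before Y).
  move=> c x y; rewrite /corner_before => /orP[h1|/andP[/eqP-> h1]] /orP[h2|/andP[/eqP<- h2]].
  - by rewrite (lt_trans h2 h1).
  - by rewrite h1.
  - by rewrite h2.
  - by rewrite eqxx (leq_trans h1 h2) orbT.
have := sort_sorted tot [seq c <- candidates Y | icorner i Y c].
rewrite -/(signature i Y) => so.
have := uniq_signature i Y; have : all (icorner i Y) (signature i Y).
  by apply/allP => c; rewrite mem_signature.
elim: (signature i Y) so => //= c l IH cl /andP[cc lc] /andP[cnl ul].
have ol := order_path_min tr cl.
rewrite (path_sortedE) ?IH ?andbT //; last 2 first.
- exact: path_sorted cl.
- by move=> a b d /= h1 h2; apply: lt_trans h2 h1.
apply/allP => x xl; apply: corner_before_position cc (allP lc _ xl) _ (allP ol _ xl).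
by apply: contraNneq cnl => ->.
Qed.

(** A strictly decreasing list is determined by its members, so signatures can be compared without
    unfolding the sort. *)
Lemma signature_eq i Y (l : seq (corner (s + t))) :
  sorted gtz [seq position Y c | c <- l] -> (forall c, (c \in l) = icorner i Y c) ->
  signature i Y = l.
Proof.
move=> so ml; have so' := sorted_signature i Y.
rewrite !sorted_map in so so'.
apply: irr_sorted_eq so' so _.
- by move=> a b d /= h1 h2; apply: lt_trans h2 h1.
- by move=> a; rewrite /= /gtz ltxx.
- by move=> c; rewrite ml mem_signature.
Qed.

Lemma sorted_pairwise Y l1 c l2 :
  sorted gtz [seq position Y x | x <- l1 ++ c :: l2] ->
  (forall x, x \in l1 -> position Y c < position Y x) /\
  (forall x, x \in l2 -> position Y x < position Y c).
Proof.
have tr : transitive gtz by move=> a b d h1 h2; apply: lt_trans h2 h1.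
rewrite (sorted_pairwise tr) pairwise_map pairwise_cat /=.
move=> /and3P[/allrelP h1 _ /andP[/allP h2 _]]; split=> x xl; last exact: h2.
by apply: h1 => //; rewrite mem_head.
Qed.

End Signature.

(** * The crystal operators as changes of one letter *)

Section Operators.
Variables s t : nat.
Implicit Types (Y : diagrams s t) (c x : corner (s + t)) (i : 'I_2)
  (l : seq (corner (s + t))).

Lemma add_atE Y j m b j' n :
  add_at Y (j, m, b) j' n = if j' == j then add_node_fun (Y j') m n else Y j' n.
Proof. by rewrite /add_at /=; case: ifP. Qed.

Lemma remove_atE Y j m b j' n :
  remove_at Y (j, m, b) j' n = if j' == j then remove_node_fun (Y j') m n else Y j' n.
Proof. by rewrite /remove_at /=; case: ifP. Qed.

Lemma diagrams_eq Y Y' : (forall j, Y j =1 Y' j) -> Y = Y'.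
Proof. by move=> e; apply: functional_extensionality_dep => j; apply: eyd_eq. Qed.

Lemma remove_atK Y j m b b' : convex (Y j) m.+1 ->
  add_at (remove_at Y (j, m.+1, b)) (j, m, b') = Y.
Proof.
move=> cm; apply: diagrams_eq => j' n; rewrite /add_at /remove_at /=.
by case: eqVneq => // -> /=; rewrite remove_node_funK //; apply: diagrams_incr.
Qed.

Lemma add_at_other Y j m b j' : j' != j -> add_at Y (j, m, b) j' = Y j'.
Proof. by rewrite /add_at /= => /negbTE->. Qed.

Lemma add_at_same Y j m b : add_at Y (j, m, b) j = add_node (Y j) m.
Proof. by rewrite /add_at /= eqxx. Qed.

Lemma icorner_add_old i Y j m x : icorner i Y (j, m, false) ->
  icorner i Y x -> x != (j, m, false) ->
  icorner i (add_at Y (j, m, false)) x /\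
  position (add_at Y (j, m, false)) x = position Y x.
Proof.
case: x => [[j' n] b] /andP[cm /modz2P[e he]] /andP[cx dx] xc.
rewrite /icorner /position !is_cornerE !corner_diagE in he cx dx *.
have [jj|jj] := eqVneq j' j; last by rewrite add_at_other // cx dx.
rewrite {}jj in xc cx dx *; rewrite add_at_same /=.
have [e' he'] := modz2P _ _ dx.
have [//||c1 ->] := corner_at_add (e := e' - e) (@diagrams_incr _ _ Y j) cm _ cx.
- by apply: contra xc; rewrite !xpair_eqE eqxx.
- by rewrite he he'; lia.
- by rewrite dx c1.
Qed.

Lemma icorner_add_new i Y j m : icorner i Y (j, m, false) ->
  icorner i (add_at Y (j, m, false)) (j, m.+1, true) /\
  position (add_at Y (j, m, false)) (j, m.+1, true) = position Y (j, m, false).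
Proof.
move=> /andP[cm dm]; have [c1 d1] := corner_at_new cm (@diagrams_incr _ _ Y j).
rewrite /icorner /position !is_cornerE !corner_diagE add_at_same.
by rewrite [diag_at _ m.+1 _]d1 [corner_at _ _ _]c1 dm.
Qed.

Lemma icorner_addV i Y j m x : icorner i Y (j, m, false) ->
  icorner i (add_at Y (j, m, false)) x -> x != (j, m.+1, true) ->
  icorner i Y x && (x != (j, m, false)).
Proof.
case: x => [[j' n] b] /andP[cm /modz2P[e he]] /andP[cx dx] xc.
rewrite /icorner !is_cornerE !corner_diagE in he cx dx *.
have [jj|jj] := eqVneq j' j; last first.
  by move: cx dx; rewrite add_at_other // => -> ->; rewrite !xpair_eqE (negbTE jj).
rewrite {}jj in xc cx dx *; rewrite add_at_same /= in cx dx.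
have [e' he'] := modz2P _ _ dx.
have xc' : (n, b) != (m.+1, true) by apply: contra xc; rewrite !xpair_eqE eqxx.
have [|c1 d1 nm] := corner_at_addV (e := e' - e) (@diagrams_incr _ _ Y j) cm xc' cx.
  by rewrite he he'; lia.
rewrite c1 -d1 dx /=; apply: contra nm.
by rewrite !xpair_eqE eqxx.
Qed.

(** A node alters corners only on its own diagonal and the two adjacent ones, which have the other
    colour; hence one letter flips and keeps its place. *)
Lemma signature_add i Y j m l1 l2 : signature i Y = l1 ++ (j, m, false) :: l2 ->
  signature i (add_at Y (j, m, false)) = l1 ++ (j, m.+1, true) :: l2.
Proof.
move=> sY; set Y' := add_at _ _; set c := (j, m, false); set c' := (j, m.+1, true).
have ic : icorner i Y c by rewrite -mem_signature sY mem_cat mem_head orbT.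
have [ic' pc'] := icorner_add_new ic.
have := uniq_signature i Y; rewrite sY uniq_catC /= mem_cat negb_or => /andP[/andP[c2 c1] _].
have mem x : x \in l1 ++ l2 -> icorner i Y x /\ x != c.
  rewrite mem_cat => xl; split.
    by rewrite -mem_signature sY mem_cat in_cons orbCA xl orbT.
  by apply: contraTneq xl => ->; rewrite negb_or c1.
have pos x : x \in l1 ++ l2 -> position Y' x = position Y x.
  by move=> /mem[ix xc]; have [] := icorner_add_old ic ix xc.
apply: signature_eq.
  have /eq_in_map e1 : {in l1, position Y' =1 position Y}.
    by move=> x xl; apply: pos; rewrite mem_cat xl.
  have /eq_in_map e2 : {in l2, position Y' =1 position Y}.
    by move=> x xl; apply: pos; rewrite mem_cat xl orbT.
  by have := sorted_signature i Y; rewrite sY !map_cat /= pc' e1 e2.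
move=> x; rewrite mem_cat in_cons orbCA -mem_cat.
have [->|xc'] /= := eqVneq x c'; first by rewrite ic'.
apply/idP/idP => [/mem[ix xc]|/(icorner_addV ic)/(_ xc')/andP[ix xc]].
  by have [] := icorner_add_old ic ix xc.
by move: ix; rewrite -mem_signature sY mem_cat in_cons (negbTE xc) -mem_cat.
Qed.

(** Adding the node back restores [Y], so [signature_add] can be read backwards; the words around
    the flipped letter agree because signatures have no repetitions. *)
Lemma signature_remove i Y j m l1 l2 : signature i Y = l1 ++ (j, m.+1, true) :: l2 ->
  signature i (remove_at Y (j, m.+1, true)) = l1 ++ (j, m, false) :: l2.
Proof.
move=> sY; set Y' := remove_at _ _.
have ic : icorner i Y (j, m.+1, true) by rewrite -mem_signature sY mem_cat mem_head orbT.
have [cm _] := andP ic.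
have : icorner i Y' (j, m, false).
  have [c1 d1] := corner_at_removed cm (@diagrams_incr _ _ Y j).
  move: ic; rewrite /icorner !is_cornerE !corner_diagE /Y' /remove_at /= eqxx /=.
  by rewrite -[concave _ _]/(corner_at _ _ false) c1 d1 => /andP[_ ->].
rewrite -mem_signature; case/path.splitPr E: {1}_ / => [p1 p2].
have := signature_add E; rewrite remove_atK // sY => /eqP.
by rewrite uniq_eqseq_pivotl -?sY ?uniq_signature // => /andP[/eqP-> /eqP->].
Qed.

Lemma ftildeP i Y Y' : ftilde i Y = Some Y' <-> exists j m l1 l2,
  [/\ signature i Y = l1 ++ (j, m, false) :: l2, all (@is_one s t) (red l1),
      all (@is_zero s t) (red l2) & Y' = add_at Y (j, m, false)].
Proof.
rewrite /ftilde -[relevant i Y]/(red (signature i Y)).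
split=> [|[j [m [l1 [l2 [sY h1 h2 ->]]]]]].
  case E: ohead => [c|] //= [<-]; move/first_zero_pivot: E => [c0 [l1 [l2 [sY h1 h2]]]].
  move: c c0 sY => [[j m] b] /negbTE /= ->; by exists j, m, l1, l2.
by rewrite (_ : ohead _ = Some (j, m, false)) //; apply/first_zero_pivot; split=> //; exists l1, l2.
Qed.

Lemma etildeP i Y Y' : etilde i Y = Some Y' <-> exists j m l1 l2,
  [/\ signature i Y = l1 ++ (j, m.+1, true) :: l2, all (@is_one s t) (red l1),
      all (@is_zero s t) (red l2) & Y' = remove_at Y (j, m.+1, true)].
Proof.
rewrite /etilde -[relevant i Y]/(red (signature i Y)).
split=> [|[j [m [l1 [l2 [sY h1 h2 ->]]]]]].
  case E: ohead => [c|] //= [<-]; move/last_one_pivot: E => [c0 [l1 [l2 [sY h1 h2]]]].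
  have : icorner i Y c by rewrite -mem_signature sY mem_cat mem_head orbT.
  (* A convex corner has positive abscissa, so the form [m.+1] loses no case. *)
  case: c c0 sY => [[j [|m]] b]; rewrite /is_one /= => ->; first by rewrite /icorner.
  by exists j, m, l1, l2.
by rewrite (_ : ohead _ = Some (j, m.+1, true)) //; apply/last_one_pivot; split=> //; exists l1, l2.
Qed.

(** The words [l1] and [l2] around the changed letter stay the same, so it is still the pivot. *)
Lemma etildeK i Y Y' : etilde i Y = Some Y' -> ftilde i Y' = Some Y.
Proof.
move=> /etildeP[j [m [l1 [l2 [sY h1 h2 ->]]]]]; apply/ftildeP.
exists j, m, l1, l2; split=> //; first exact: signature_remove.
rewrite remove_atK //.
have : icorner i Y (j, m.+1, true) by rewrite -mem_signature sY mem_cat mem_head orbT.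
by case/andP.
Qed.

(** Termination measure for repeated application of [etilde]. *)
Lemma count_etilde i Y Y' : etilde i Y = Some Y' ->
  (count (@is_one s t) (signature i Y') < count (@is_one s t) (signature i Y))%N.
Proof.
move=> /etildeP[j [m [l1 [l2 [sY h1 h2 ->]]]]].
by rewrite (signature_remove sY) sY !count_cat /= ltn_add2l.
Qed.

(** A leading 1 has no 0 before it and so stays relevant. *)
Lemma etilde_first i Y c l : signature i Y = c :: l -> is_one c -> etilde i Y <> None.
Proof.
rewrite /etilde -[relevant i Y]/(red (signature i Y)) => -> c1.
by rewrite /= push_one //= (c1 : c.2) rev_cons; case: rev.
Qed.

End Operators.

(** * Neighbouring letters of the signature as rows of a periodic cover *)

Section Neighbours.
Variables s t : nat.
Implicit Types (Y : diagrams s t) (c x : corner (s + t)) (i : 'I_2)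
  (l : seq (corner (s + t))).

Lemma signature_pred i Y l1 c l2 c' : signature i Y = l1 ++ c :: l2 ->
  icorner i Y c' -> position Y c < position Y c' ->
  (forall x, icorner i Y x -> position Y c < position Y x ->
     position Y c' <= position Y x) ->
  exists p, l1 = rcons p c'.
Proof.
move=> sY ic' cc' min; have := sorted_signature i Y; rewrite sY => so.
have [lt1 lt2] := sorted_pairwise so.
have c'1 : c' \in l1.
  move: ic'; rewrite -mem_signature sY mem_cat in_cons => /or3P[//|/eqP e|/lt2].
    by rewrite e ltxx in cc'.
  by rewrite ltNge (ltW cc').
have ml x : x \in l1 -> icorner i Y x.
  by move=> xl; rewrite -mem_signature sY mem_cat xl.
case/path.splitPr: {l1} c'1 sY so lt1 ml => p1 p2 sY so lt1 ml; exists p1.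
case: p2 sY so lt1 ml => [|x p2] sY so lt1 ml; first by rewrite cats1.
have xl : x \in p1 ++ c' :: x :: p2 by rewrite mem_cat !in_cons eqxx !orbT.
have := min x (ml x xl) (lt1 x xl).
rewrite -catA in so; have [_ /(_ x)] := sorted_pairwise so.
by rewrite ltNge mem_head => /(_ isT)/negbTE->.
Qed.

Lemma signature_succ i Y l1 c l2 c' : signature i Y = l1 ++ c :: l2 ->
  icorner i Y c' -> position Y c' < position Y c ->
  (forall x, icorner i Y x -> position Y x < position Y c ->
     position Y x <= position Y c') ->
  exists p, l2 = c' :: p.
Proof.
move=> sY ic' cc' max; have := sorted_signature i Y; rewrite sY => so.
have [lt1 lt2] := sorted_pairwise so.
have c'2 : c' \in l2.
  move: ic'; rewrite -mem_signature sY mem_cat in_cons => /or3P[/lt1|/eqP e|//].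
    by rewrite ltNge (ltW cc').
  by rewrite e ltxx in cc'.
have ml x : x \in l2 -> icorner i Y x.
  by move=> xl; rewrite -mem_signature sY mem_cat in_cons xl !orbT.
case/path.splitPr: {l2} c'2 sY so lt2 ml => p1 p2 sY so lt2 ml; exists p2.
case: p1 sY so lt2 ml => [//|x p1] sY so lt2 ml.
have xl : x \in (x :: p1) ++ c' :: p2 by rewrite mem_head.
have := max x (ml x xl) (lt2 x xl).
rewrite -cat_rcons catA in so; have [/(_ x)] := sorted_pairwise so.
by rewrite ltNge mem_cat mem_head orbT => /(_ isT)/negbTE->.
Qed.

Lemma signature_head i Y c : icorner i Y c ->
  (forall x, icorner i Y x -> position Y x <= position Y c) ->
  exists l, signature i Y = c :: l.
Proof.
move=> ic max; have := ic; rewrite -mem_signature.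
case/path.splitPr E: {1}_ / => [p1 p2].
case: p1 E => [|x p1] E; first by exists p2.
have := sorted_signature i Y; rewrite E => /sorted_pairwise[/(_ x)].
rewrite mem_head ltNge max; first by move=> /(_ isT).
by rewrite -mem_signature E mem_cat mem_head.
Qed.

Variable k0 : (0 < s + t)%N.

Definition residue J : 'I_(s + t) := Ordinal (ltn_pmod J k0).

(* Going once around shifts diagonals by 2 and so preserves colours. On a fixed
   diagonal of the cover, consecutive indices [J] are consecutive positions in the
   signature, see [position_cover]. *)
Definition cover Y J m : int := Y (residue J) m + (J %/ (s + t))%:Z *+ 2.

Lemma cover_incr Y J : incr (cover Y J).
Proof. by move=> m; rewrite lerD2r; apply: eyd_mono. Qed.

Lemma cover_period Y J m : cover Y (J + (s + t)) m = cover Y J m + 2.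
Proof.
rewrite /cover (_ : residue (J + (s + t)) = residue J).
  by rewrite divnDr // divnn k0; lia.
by apply: val_inj; rewrite /= modnDr.
Qed.

Lemma residue_ord (j : 'I_(s + t)) q : residue (j + q * (s + t)) = j.
Proof. by apply: val_inj; rewrite /= addnC modnMDl modn_small. Qed.

Lemma quotient_ord (j : 'I_(s + t)) q : ((j + q * (s + t)) %/ (s + t) = q)%N.
Proof. by rewrite addnC divnMDl // divn_small // addn0. Qed.

Lemma residue_eq J (j : 'I_(s + t)) q :
  (residue J == j) = (J == j + q * (s + t) %[mod s + t])%N.
Proof. by rewrite -{1}(residue_ord j q). Qed.

Lemma corner_at_cover Y J m b :
  corner_at (cover Y J) m b = is_corner Y (residue J, m, b).
Proof. exact: corner_at_shift. Qed.

Lemma diag_at_cover Y J m b : diag_at (cover Y J) m b =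
  corner_diag Y (residue J, m, b) + (J %/ (s + t))%:Z *+ 2.
Proof. exact: diag_at_shift. Qed.

Lemma position_cover Y J m b : position Y (residue J, m, b) =
  diag_at (cover Y J) m b * (s + t)%:Z - J%:Z *+ 2.
Proof.
rewrite diag_at_cover /position; move: (corner_diag _ _) => d.
rewrite /= [X in _ = _ - X%:Z *+ 2](divn_eq J (s + t)); lia.
Qed.

(** Positions in one colour differ by an even number [2e], and [x] appears on the diagonal of
    [(j, m, b)] in the row [e] steps back. The [q] extra turns leave room for a natural row
    index. *)
Lemma position_same_color i Y j m b x q :
  icorner i Y (j, m, b) -> icorner i Y x ->
  exists e : int, position Y x = position Y (j, m, b) + e *+ 2 /\
    forall J : nat, J%:Z = j%:Z + q%:Z * (s + t)%:Z - e ->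
      residue J = x.1.1 /\
      diag_at (cover Y J) x.1.2 x.2 = corner_diag Y (j, m, b) + q%:Z *+ 2.
Proof.
case: x => [[j' n] b'] /andP[_ /modz2P[e he]] /andP[_ /modz2P[e' he']].
rewrite /position he he'.
exists ((e' - e) * (s + t)%:Z - j'%:Z + j%:Z); split=> [|J hJ] /=; first by ring.
have jk' := ltn_ord j'.
have [w hw] : exists w : nat, q%:Z - e' + e = w%:Z.
  by exists (absz (q%:Z - e' + e)); rewrite gez0_abs //; nia.
have JE : J = (j' + w * (s + t))%N by nia.
have rJ : residue J = j' by rewrite JE residue_ord.
split=> //; rewrite diag_at_cover rJ he' JE quotient_ord; lia.
Qed.

Lemma color_cover i Y J m b (d : int) q : (d == (i : nat)%:Z %[mod 2])%Z ->
  diag_at (cover Y J) m b = d + q%:Z *+ 2 ->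
  (corner_diag Y (residue J, m, b) == (i : nat)%:Z %[mod 2])%Z.
Proof.
rewrite diag_at_cover => /modz2P[e ->] E; apply/modz2P.
by exists (e + q%:Z - (J %/ (s + t))%:Z); lia.
Qed.

(** A concave corner forbidden by [cylindric_add] would be the letter just before [c] in the
    signature, and [red l1] would end in 0. *)
Lemma cylindric_ftilde i Y Y' :
  cylindric (cover Y) -> ftilde i Y = Some Y' -> cylindric (cover Y').
Proof.
move=> cylY /ftildeP[j [m [l1 [l2 [sY l11 _ ->]]]]].
set c := (j, m, false) in sY *.
have ic : icorner i Y c by rewrite -mem_signature sY mem_cat mem_head orbT.
have [cm dm] := andP ic.
(* One turn is added so that the [s + t] rows before [J] have natural indices. *)
set J := (j + 1 * (s + t))%N.
have rJ : residue J = j by rewrite residue_ord.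
have dJ : diag_at (cover Y J) m false = corner_diag Y c + 2.
  by rewrite diag_at_cover rJ quotient_ord.
apply: (@cylindric_add _ _ k0 (@cover_incr Y) (@cover_period Y) _ J m cylY).
- by rewrite /J mul1n leq_addl.
- by rewrite -[concave _ _]/(corner_at _ _ false) corner_at_cover rJ.
- move=> J' n; rewrite /cover add_atE (residue_eq J' j 1) -/J.
  case: eqVneq => [E|]; last by rewrite subr0.
  have E' : residue J' = j by apply/eqP; rewrite (residue_eq J' j 1) -/J; apply/eqP.
  by rewrite E' add_node_funE //=; case: ifP; lia.
move=> r /andP[r0 rk] free n cn; rewrite dJ => dn.
set K := (J - r)%N in cn dn.
have JK : K%:Z = J%:Z - r%:Z by rewrite /K /J; lia.
have ic' : icorner i Y (residue K, n, false).
  apply/andP; split; first by rewrite -corner_at_cover.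
  by apply: (color_cover (q := 1) dm); rewrite dn.
have pc' : position Y (residue K, n, false) = position Y c + r%:Z *+ 2.
  by rewrite position_cover dn JK /position /J /=; lia.
have [||p pl] := signature_pred sY ic'; first by lia.
  (* A letter strictly between the two would be a corner on the same diagonal in some row [J - r']
     with [0 < r' < r], against [free]. *)
  move=> x ix lt; have := position_same_color 1 ic ix; rewrite -/c => -[e [E h]].
  rewrite leNgt; apply/negP => lt'; rewrite E pc' in lt lt'.
  have [r' r'E] : exists r' : nat, e = r'%:Z.
    by exists (absz e); rewrite gez0_abs //; lia.
  have [rx dx] := h (J - r')%N ltac:(rewrite /J; lia).
  apply: (free r' x.1.2 x.2); first by lia.
    rewrite corner_at_cover rx; have [+ _] := andP ix.
    by case: (x) => [[? ?] ?].
  by rewrite dx dJ.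
move: l11; rewrite pl -cats1 red_cat_zeros // all_cat /=.
by rewrite andbF.
Qed.

(** Dually, a forbidden convex corner would be the letter just after [c], and [red l2] would not
    consist of zeros. *)
Lemma cylindric_etilde i Y Y' :
  cylindric (cover Y) -> etilde i Y = Some Y' -> cylindric (cover Y').
Proof.
move=> cylY /etildeP[j [m [l1 [l2 [sY _ l20 ->]]]]].
set c := (j, m.+1, true) in sY *.
have ic : icorner i Y c by rewrite -mem_signature sY mem_cat mem_head orbT.
have [cm dm] := andP ic.
have rj : residue j = j by rewrite -[in LHS](addn0 j) -(mul0n (s + t)) residue_ord.
have dj : diag_at (cover Y j) m.+1 true = corner_diag Y c.
  by rewrite diag_at_cover rj divn_small ?ltn_ord // addr0.
apply: (@cylindric_remove _ _ k0 (@cover_incr Y) (@cover_period Y) _ j m cylY).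
- by rewrite -[convex _ _]/(corner_at _ _ true) corner_at_cover rj.
- move=> J' n; rewrite /cover remove_atE (residue_eq J' j 0) mul0n addn0.
  case: eqVneq => [E|]; last by rewrite addr0.
  have E' : residue J' = j by apply/eqP; rewrite (residue_eq J' j 0) mul0n addn0; apply/eqP.
  by rewrite E' remove_node_funE //=; case: ifP; lia.
move=> r /andP[r0 rk] free n cn; rewrite dj => dn.
set K := (j + r)%N in cn dn.
have ic' : icorner i Y (residue K, n, true).
  apply/andP; split; first by rewrite -corner_at_cover.
  by apply: (color_cover (q := 0) dm); rewrite dn addr0.
have pc' : position Y (residue K, n, true) = position Y c - r%:Z *+ 2.
  by rewrite position_cover dn /position /K /=; lia.
have [||p pl] := signature_succ sY ic'; first by lia.
  move=> x ix lt; have := position_same_color 0 ic ix; rewrite -/c => -[e [E h]].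
  rewrite leNgt; apply/negP => lt'; rewrite E pc' in lt lt'.
  have [r' r'E] : exists r' : nat, e = - r'%:Z.
    by exists (absz e); rewrite lez0_abs ?opprK //; lia.
  have [rx dx] := h (j + r')%N ltac:(lia).
  apply: (free r' x.1.2 x.2); first by lia.
    rewrite corner_at_cover rx; have [+ _] := andP ix.
    by case: (x) => [[? ?] ?].
  by rewrite dx dj addr0.
by move: l20; rewrite pl -cat1s red_cat_ones.
Qed.

End Neighbours.

(** * Widths of admissible tuples and the first letter of the signature *)

Section Widths.
Variables s t : nat.
Implicit Types (Y : diagrams s t) (i : 'I_2).

Lemma diagrams_le_charge Y j m : Y j m <= charge s j.
Proof. exact: eyd_le. Qed.

Lemma charge0 j : (j < s)%N -> charge s j = 0.
Proof. by rewrite /charge => ->. Qed.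

Lemma charge1 j : (s <= j)%N -> charge s j = 1.
Proof. by rewrite /charge ltnNge => ->. Qed.

(** Sharpens [corner_bound] by 1 when the extreme diagonal has the wrong colour. *)
Lemma corner_diag_bound Y i n j m b : Y j n = charge s j -> icorner i Y (j, m, b) ->
  corner_diag Y (j, m, b) <= n%:Z + charge s j - (odd n (+) (charge s j == 1) (+) odd i)%:Z.
Proof.
move=> Yn /andP[cx /modz2P[e he]].
have := corner_bound (@diagrams_incr _ _ Y j) Yn (diagrams_le_charge Y j) cx.
rewrite -corner_diagE he /charge; have := ltn_ord i; case: (j < s)%N; lia.
Qed.

(** The convex corner of abscissa [m + 1] of component 0 lies on diagonal [m]. All corners lie on
    diagonals at most [m + 1], hence at most [m] by colour, and component 0 wins ties. *)
Lemma etilde_charge0 Y i m (o : 'I_(s + t)) : o = 0%N :> nat -> (0 < s)%N ->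
  (forall j, Y j m.+1 = charge s j) ->
  (forall j : 'I_(s + t), (s <= j)%N -> Y j m = 1) -> Y o m = -1 ->
  odd m = odd i -> etilde i Y <> None.
Proof.
move=> o0 s0 Ym1 Ym Yo mi; have Co : charge s o = 0 by rewrite /charge o0 s0.
have dc : corner_diag Y (o, m.+1, true) = m%:Z by rewrite /= Yo; lia.
have ic : icorner i Y (o, m.+1, true).
  rewrite /icorner dc is_cornerE /= /convex /= Yo Ym1 Co /=; apply/modz2P.
  by exists (m./2)%:Z; have := ltn_ord i; lia.
have [|l sY] := signature_head ic; last exact: etilde_first sY _.
case=> [[j n] b] ix; rewrite /position dc /= o0.
suff : corner_diag Y (j, n, b) <= m%:Z by rewrite /=; nia.
have [js|js] := ltnP j s.
  by have := corner_diag_bound (Ym1 j) ix; rewrite /charge js; lia.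
have Cj : charge s j = 1 by rewrite /charge ltnNge js.
by have := corner_diag_bound (etrans (Ym _ js) (esym Cj)) ix; rewrite Cj; lia.
Qed.

(** The corner of the first component of charge 1 lies on diagonal [m + 1], the maximum for this
    colour. Components of charge 0 would win ties but reach at most diagonal [m]. *)
Lemma etilde_charge1 Y i m (o : 'I_(s + t)) : o = s :> nat ->
  (forall j, Y j m.+1 = charge s j) ->
  (forall j : 'I_(s + t), (j < s)%N -> Y j m = 0) -> Y o m = 0 ->
  odd m.+1 = odd i -> etilde i Y <> None.
Proof.
move=> o0 Ym1 Ym Yo mi; have Co : charge s o = 1 by rewrite /charge o0 ltnn.
have dc : corner_diag Y (o, m.+1, true) = m.+1%:Z by rewrite /= Yo; lia.
have ic : icorner i Y (o, m.+1, true).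
  rewrite /icorner dc is_cornerE /= /convex /= Yo Ym1 Co /=; apply/modz2P.
  by exists (m.+1./2)%:Z; have := ltn_ord i; lia.
have [|l sY] := signature_head ic; last exact: etilde_first sY _.
case=> [[j n] b] ix; rewrite /position dc /= o0.
have [js|js] := ltnP j s.
  have Cj : charge s j = 0 by rewrite /charge js.
  suff : corner_diag Y (j, n, b) <= m%:Z - 1 by rewrite /=; nia.
  by have := corner_diag_bound (etrans (Ym _ js) (esym Cj)) ix; rewrite Cj; lia.
suff : corner_diag Y (j, n, b) <= m.+1%:Z by rewrite /=; nia.
by have := corner_diag_bound (Ym1 j) ix; rewrite /charge ltnNge js /=; lia.
Qed.

(** All components are constrained here; [bounded_width] reduces this to the first one of each
    charge. *)
Definition bounded a b Y : Prop :=
  forall j : 'I_(s + t), Y j (if (j < s)%N then a else b) = charge s j.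

(** Quantifying over [k0] makes the condition vacuous for [s + t = 0], where there is no cover. *)
Definition admissible Y : Prop := forall k0, cylindric (cover k0 Y).

Lemma cover_ord k0 Y (j : 'I_(s + t)) m : cover k0 Y j m = Y j m.
Proof.
have rj : residue k0 j = j by rewrite -[in LHS](addn0 j) -(mul0n (s + t)) residue_ord.
by rewrite /cover rj divn_small ?ltn_ord // addr0.
Qed.

Lemma cover_le k0 Y J J' m : admissible Y -> (J <= J')%N ->
  cover k0 Y J m <= cover k0 Y J' m.
Proof.
move=> /(_ k0)[c1 _] /subnK <-; elim: (J' - J)%N => // p /le_trans; apply.
by rewrite addSn; apply: c1.
Qed.

Lemma admissible_le Y (j j' : 'I_(s + t)) m : admissible Y -> (j <= j')%N ->
  Y j m <= Y j' m.
Proof.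
move=> aY jj'; have k0 : (0 < s + t)%N by apply: leq_ltn_trans (ltn_ord j).
by rewrite -!(cover_ord k0); apply: cover_le.
Qed.

(** Component [j] comes before the end of the turn that starts at component 0, and a turn adds 2. *)
Lemma admissible_le2 Y (o j : 'I_(s + t)) m : admissible Y -> o = 0%N :> nat ->
  Y j m <= Y o m + 2.
Proof.
move=> aY o0; have k0 : (0 < s + t)%N by apply: leq_ltn_trans (ltn_ord j).
rewrite -!(cover_ord k0) -cover_period; apply: cover_le => //.
by rewrite o0 ltnW.
Qed.

Lemma bounded_exists Y : exists n, bounded n n Y.
Proof.
exists (\max_j width (Y j)) => j; rewrite if_same; apply/width_le.
exact: (@bigop.leq_bigmax _ (fun j => width (Y j))).
Qed.

Lemma bounded_le a b a' b' Y : (a <= a')%N -> (b <= b')%N ->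
  bounded a b Y -> bounded a' b' Y.
Proof.
move=> aa bb bY j; have := bY j; move=> e; apply/eqP.
rewrite eq_le diagrams_le_charge -[X in X <= _]e /=.
by apply: incr_le; [apply: diagrams_incr|case: ifP].
Qed.

(* In both cases the first entry of the signature is the convex corner of the
   last column of the first component of the relevant charge. *)
Lemma last_column Y m (j0 : 'I_(s + t)) : admissible Y ->
  bounded m.+1 m.+1 Y -> Y j0 m <> charge s j0 ->
  [/\ bounded m.+1 m Y, exists2 j : 'I_(s + t), (j < s)%N & Y j m <> 0 &
    forall i, odd m = odd i -> etilde i Y <> None] \/
  [/\ bounded m m.+1 Y, exists2 j : 'I_(s + t), (s <= j)%N & Y j m <> 1 &
    forall i, odd m.+1 = odd i -> etilde i Y <> None].
Proof.
move=> aY bY j0m; have k0 : (0 < s + t)%N by apply: leq_ltn_trans (ltn_ord j0).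
have {}bY j : Y j m.+1 = charge s j by have := bY j; rewrite if_same.
have {}j0m : Y j0 m < charge s j0.
  by rewrite lt_neqAle diagrams_le_charge andbT; apply/eqP.
(* The second condition for column [m] is moved to a row [j] among the actual components; row
   [j + 1] may be component 0 raised by 2. *)
have [_ /(_ m)[J hJ]] := aY k0.
pose j := residue k0 J.
have {}hJ : Y j m.+1 < cover k0 Y j.+1 m.
  have /(shift_mod k0 (@cover_period _ _ k0 Y))[e he] : J = j %[mod s + t].
    by rewrite /= modn_mod.
  have := he 0%N m.+1; have := he 1%N m; rewrite !addn1 !addn0 cover_ord.
  lia.
move: (j) hJ => {}j; rewrite bY => hJ.
pose o := Ordinal k0; have o0 : o = 0%N :> nat by [].
have oj (j' : 'I_(s + t)) : Y o m <= Y j' m by apply: admissible_le.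
have lastj : (j.+1 < s + t)%N \/ j.+1 = (s + t)%N by have := ltn_ord j; lia.
have zero : (forall j' : 'I_(s + t), (s <= j')%N -> Y j' m = 1) -> -1 <= Y o m ->
  [/\ bounded m.+1 m Y, exists2 j : 'I_(s + t), (j < s)%N & Y j m <> 0 &
    forall i, odd m = odd i -> etilde i Y <> None].
  move=> h1 h2.
  have j0s : (j0 < s)%N.
    by rewrite ltnNge; apply/negP => h; have := h1 _ h; have := charge1 h; lia.
  have C0 := charge0 j0s.
  split=> [j'||i].
  - by case: ltnP => // j's; rewrite h1 // charge1.
  - by exists j0 => //; lia.
  apply: (etilde_charge0 o0) => //; first by apply: leq_ltn_trans j0s.
  by have := oj j0; lia.
have one : 0 <= Y o m ->
  [/\ bounded m m.+1 Y, exists2 j : 'I_(s + t), (s <= j)%N & Y j m <> 1 &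
    forall i, odd m.+1 = odd i -> etilde i Y <> None].
  move=> h2; have h1 (j' : 'I_(s + t)) : (j' < s)%N -> Y j' m = 0.
    move=> j's; have := oj j'; have := diagrams_le_charge Y j' m.
    by have := charge0 j's; lia.
  have j0s : (s <= j0)%N.
    by rewrite leqNgt; apply/negP => h; have := h1 _ h; have := charge0 h; lia.
  have sk : (s < s + t)%N by apply: leq_ltn_trans (ltn_ord j0).
  have C0 := charge1 j0s.
  split=> [j'||i].
  - by case: ltnP => // j's; rewrite h1 // charge0.
  - by exists j0 => //; lia.
  apply: (@etilde_charge1 _ _ _ (Ordinal sk)) => //.
  have : Y (Ordinal sk) m <= Y j0 m by apply: admissible_le.
  by have := oj (Ordinal sk); lia.
(* If [j] has charge 0, row [j + 1] is positive in column [m]: either it has charge 1, and all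
   components of charge 1 have reached 1 there, or it is component 0 raised by 2. Either way [Y o m]
   is at least -1. If [j] has charge 1, only the raised component 0 can exceed 1, so [Y o m] is
   nonnegative. *)
have [js|js] := ltnP j s.
  left; have Cj := charge0 js; case: lastj => lastj.
    rewrite -[j.+1]/(nat_of_ord (Ordinal lastj)) cover_ord in hJ.
    have := diagrams_le_charge Y (Ordinal lastj) m.
    have [sj|sj] := ltnP (Ordinal lastj) s; first by have := charge0 sj; lia.
    have C1 := charge1 sj => hJ'.
    have h1 (j' : 'I_(s + t)) : (s <= j')%N -> Y j' m = 1.
      move=> sj'; have : Y (Ordinal lastj) m <= Y j' m.
        by apply: admissible_le => //=; lia.
      by have := diagrams_le_charge Y j' m; have := charge1 sj'; lia.
    apply: zero => //; have := admissible_le2 (Ordinal lastj) m aY o0.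
    by rewrite h1 //; lia.
  rewrite (_ : j.+1 = o + (s + t))%N // cover_period cover_ord in hJ.
  apply: zero => [j' sj'|]; last by lia.
  by have := ltn_ord j'; lia.
right; have Cj := charge1 js; apply: one; case: lastj => lastj.
  rewrite -[j.+1]/(nat_of_ord (Ordinal lastj)) cover_ord in hJ.
  have := diagrams_le_charge Y (Ordinal lastj) m.
  have /charge1 : (s <= Ordinal lastj)%N by rewrite /= leqW.
  lia.
by rewrite (_ : j.+1 = o + (s + t))%N // cover_period cover_ord in hJ; lia.
Qed.

End Widths.

(** * Lengths in the infinite dihedral group *)

Section DihedralGroup.
Implicit Types (i j : 'I_2) (w : 'M[int]_2).

Lemma ord2P i : i = 0 \/ i = 1.
Proof. by case: i => [[|[|//]] h]; [left|right]; apply: val_inj. Qed.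

Lemma ord2_odd i j : odd i = odd j -> i = j.
Proof. by case: (ord2P i) => ->; case: (ord2P j) => ->. Qed.

Lemma odd_flip i : odd (1 - i : 'I_2)%R = ~~ odd i.
Proof. by case: (ord2P i) => ->. Qed.

Lemma flipK i : 1 - (1 - i) = i.
Proof. exact: subKr. Qed.

Lemma neq_flip i j : i != j -> i = 1 - j.
Proof. by case: (ord2P i) => ->; case: (ord2P j) => -> // _; apply: val_inj. Qed.

Lemma mul_refl w i k j : (w * refl i) k j = w k j - w k i * cartan i j.
Proof.
have sum_delta l : \sum_(m < 2) w k m * (m == l)%:R = w k l.
  rewrite (bigD1 l) //= eqxx mulr1 big1 ?addr0 // => m /negbTE->.
  by rewrite mulr0.
rewrite mxE -(sum_delta i) mulr_suml -{1}(sum_delta j) -sumrB.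
by apply: eq_bigr => l _; rewrite mxE mulrBr mulrA.
Qed.

Lemma refl_sqr i : refl i * refl i = 1.
Proof.
apply/matrixP => k j; rewrite mul_refl !mxE /cartan eqxx; ring.
Qed.

(** Column [j] holds the image of the [j]-th simple root, so this is the height of that root. *)
Definition colsum w j : int := w 0 j + w 1 j.

Lemma colsum_refl w i j :
  colsum (w * refl i) j = colsum w j - colsum w i * cartan i j.
Proof. by rewrite /colsum !mul_refl; ring. Qed.

Lemma colsum_walt i L : colsum (walt i L) i = 1 - L%:Z *+ 2 /\
  colsum (walt i L) (1 - i) = 1 + L%:Z *+ 2.
Proof.
elim: L i => [|L IH] i /=.
  by rewrite /colsum !mxE; case: (ord2P i) => ->.
have [h1 h2] := IH (1 - i); rewrite flipK in h2.
rewrite !colsum_refl h1 h2 /cartan eqxx.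
by rewrite (_ : (i == 1 - i) = false); [split; lia|case: (ord2P i) => ->].
Qed.

(** With equal last letters the heights give the length. With different ones a height would be both
    [1 - 2L] and [1 + 2L'], so both lengths vanish. *)
Lemma walt_inj i j L L' : walt i L = walt j L' -> L = L'.
Proof.
have [->|ij] := eqVneq i j.
  by move=> e; have [] := colsum_walt j L; rewrite e; have [] := colsum_walt j L'; lia.
rewrite (neq_flip ij).
move=> e; have [h1 h2] := colsum_walt (1 - j) L; have [] := colsum_walt j L'.
by rewrite -e h1; rewrite flipK in h2; rewrite h2; lia.
Qed.

Lemma wprod_rcons l i : wprod (rcons l i) = wprod l * refl i.
Proof. by rewrite /wprod -cats1 big_cat big_seq1. Qed.

(** A letter appended to an alternating word either cancels its last letter or extends it. *)
Lemma wprod_walt l : exists i n, wprod l = walt i n /\ (n <= size l)%N.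
Proof.
elim/last_ind: l => [|l j [i [n [IH nl]]]].
  by exists 0, 0%N; rewrite /wprod big_nil.
rewrite wprod_rcons size_rcons IH; case: n nl {IH} => [|n] nl.
  by exists j, 1%N.
have [<-|ij] := eqVneq i j.
  exists (1 - i), n; split; last by lia.
  by rewrite /= -mulrA refl_sqr mulr1.
exists j, n.+2; split; last by lia.
by rewrite [in LHS](neq_flip ij).
Qed.

Lemma walt_word i L : exists2 l, size l = L & wprod l = walt i L.
Proof.
elim: L i => [|L IH] i; first by exists [::]; rewrite ?/wprod ?big_nil.
have [l sl wl] := IH (1 - i); exists (rcons l i); first by rewrite size_rcons sl.
by rewrite wprod_rcons wl.
Qed.

Lemma wlength_walt i L : wlength (walt i L) = L.
Proof.
have shortest l : wprod l = walt i L -> (L <= size l)%N.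
  by move=> e; have [j [n [e' nl]]] := wprod_walt l; rewrite (@walt_inj i j L n) // -e.
rewrite /wlength; case: xgetP => [n _ [[l <- wl] min]|/(_ L)[]].
  apply/eqP; rewrite eqn_leq shortest // andbT.
  by have [l' {2}<- /min] := walt_word i L.
by split=> //; apply: walt_word.
Qed.

(** The leftmost letter of [walt i L.+1], not of [walt i L]. *)
Fixpoint lead i L : 'I_2 := if L is L'.+1 then lead (1 - i) L' else i.

Lemma odd_lead i L : odd (lead i L) = odd i (+) odd L.
Proof. by elim: L i => [|L IH] i /=; rewrite ?addbF // IH odd_flip addNb addbN. Qed.

Lemma walt_lead i L : walt i L.+1 = refl (lead i L) * walt i L.
Proof.
elim: L i => [|L IH] i; first by rewrite /= mul1r mulr1.
by rewrite -[LHS]/(walt (1 - i) L.+1 * refl i) IH -mulrA.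
Qed.

Lemma refl_walt i L : refl (lead i L) * walt i L.+1 = walt i L.
Proof. by rewrite walt_lead mulrA refl_sqr mul1r. Qed.

Lemma bruhat_length (u v : 'M[int]_2) : bruhat u v -> (wlength u < wlength v)%N.
Proof. by elim=> [x y []|x y z _ + _] //; apply: ltn_trans. Qed.

Lemma bruhat_walt i L : bruhat (walt i L) (walt i L.+1).
Proof.
apply: t_step; split; last by rewrite !wlength_walt.
  by have [l _ <-] := walt_word i L; exists l.
exists (refl (lead i L)); last exact: walt_lead.
exists 1; first by exists [::]; rewrite /wprod big_nil.
by exists (lead i L); rewrite invr1 mulr1 mul1r.
Qed.

(** The other generator is the leftmost letter of [walt i L.+2], so it lengthens the word. *)
Lemma bruhat_lead i j L : bruhat (refl j * walt i L.+1) (walt i L.+1) -> j = lead i L.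
Proof.
move=> /bruhat_length; have [->//|ij] := eqVneq j (lead i L).
rewrite (_ : j = lead i L.+1) -?walt_lead ?wlength_walt; first by lia.
apply: ord2_odd; rewrite odd_lead /= addbN -odd_lead.
by rewrite (neq_flip ij) odd_flip.
Qed.

Lemma not_bruhat_refl1 i : ~ bruhat (refl i * 1) 1.
Proof.
rewrite mulr1 => /bruhat_length; rewrite -[refl i]mul1r.
by rewrite -[1 * _]/(walt i 1) -[1 in X in (_ < X)%N]/(walt i 0) !wlength_walt.
Qed.

End DihedralGroup.

(** * Demazure crystals of alternating words, one string at a time *)

Section Demazure.
Variables s t : nat.
Implicit Types Y b : diagrams s t.

Lemma demazure_walt0 i Y : demazure s t (walt i 0) Y -> Y = Phi s t.
Proof.
move E: (walt i 0) => w d.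
by case: d E => // j {}w b b' m br _ _ _ E; rewrite -E in br; case: (not_bruhat_refl1 br).
Qed.

Lemma demazure_waltS i L Y : demazure s t (walt i L.+1) Y -> exists b m,
  [/\ demazure s t (walt i L) b, etilde (lead i L) b = None &
      iter m (obind (ftilde (lead i L))) (Some b) = Some Y].
Proof.
move E: (walt i L.+1) => w d; case: d E => [E|j {}w b b' m br db eb fb E].
  by have /walt_inj : walt i 0 = walt i L.+1 by rewrite E.
rewrite -E in br db; have je := bruhat_lead br; rewrite je refl_walt in db eb fb.
by exists b, m.
Qed.

Lemma demazure_intro i L b Y m : demazure s t (walt i L) b ->
  etilde (lead i L) b = None ->
  iter m (obind (ftilde (lead i L))) (Some b) = Some Y ->
  demazure s t (walt i L.+1) Y.
Proof.
move=> db eb; apply: (@demazure_string s t (lead i L) _ b); rewrite ?refl_walt //.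
exact: bruhat_walt.
Qed.

End Demazure.

(** * Induction on the length *)

Section Main.
Variables s t : nat.
Implicit Types (Y b : diagrams s t) (i : 'I_2).

(** Exceeding a bound would use the concave corner [(p, 0)] in charge 0 or [(q, 1)] in charge 1;
    their diagonals [p] and [q + 1] have the wrong colour. *)
Lemma bounded_ftilde i p q Y Y' : odd p <> odd i -> odd q = odd i ->
  bounded p q Y -> ftilde i Y = Some Y' -> bounded p q Y'.
Proof.
move=> pi qi bY /ftildeP[j [m [l1 [l2 [sY _ _ ->]]]]] j'; rewrite add_atE.
case: eqVneq => [{j'}->|_]; last exact: bY.
have : icorner i Y (j, m, false) by rewrite -mem_signature sY mem_cat mem_head orbT.
move=> /andP[cm /modz2P[e /= he]]; rewrite add_node_funE //.
have := bY j; have := ltn_ord i.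
have [js|js] := ltnP j s; [have := charge0 js|have := charge1 js].
all: by case: eqP => [E|_] //; rewrite E in pi qi *; lia.
Qed.

Lemma bounded_etilde i p q Y Y' :
  bounded p q Y -> etilde i Y = Some Y' -> bounded p q Y'.
Proof.
move=> bY /etildeP[j [m [l1 [l2 [sY _ _ ->]]]]] j'; rewrite remove_atE.
case: eqVneq => [{j'}->|_]; last exact: bY.
have : icorner i Y (j, m.+1, true) by rewrite -mem_signature sY mem_cat mem_head orbT.
move=> /andP[cm _]; rewrite remove_node_funE //; have := bY j.
move: (if _ then p else q) => n Yn; case: eqP => [nm|//].
move: cm; rewrite /= /convex /= -nm => lt.
by have := diagrams_le_charge Y j n.+1; lia.
Qed.

Lemma admissible_ftilde i Y Y' : admissible Y -> ftilde i Y = Some Y' -> admissible Y'.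
Proof. by move=> aY f k0; apply: cylindric_ftilde f. Qed.

Lemma admissible_etilde i Y Y' : admissible Y -> etilde i Y = Some Y' -> admissible Y'.
Proof. by move=> aY f k0; apply: cylindric_etilde f. Qed.

Lemma admissible_Phi : admissible (Phi s t).
Proof.
move=> k0; pose o := Ordinal k0.
have next J : cover k0 (Phi s t) J 0 <= cover k0 (Phi s t) J.+1 0 /\
    (residue k0 J = (s + t).-1 :> nat ->
     cover k0 (Phi s t) J 0 < cover k0 (Phi s t) J.+1 0).
  have [e he] : exists e, forall p m, cover k0 (Phi s t) (J + p) m =
      cover k0 (Phi s t) (residue k0 J + p) m + e.
    by apply: (shift_mod k0 (@cover_period _ _ k0 _)); rewrite /= modn_mod.
  have := he 0%N 0%N; have := he 1%N 0%N; rewrite !addn0 !addn1 => -> ->.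
  move: (residue k0 J) => j; rewrite cover_ord /=.
  have [jk|jk] : (j.+1 < s + t)%N \/ j.+1 = (o + (s + t))%N by have := ltn_ord j; rewrite /=; lia.
    rewrite -[j.+1]/(nat_of_ord (Ordinal jk)) cover_ord /= /charge.
    by split=> [|h]; [case: (ltnP j s); case: (ltnP j.+1 s)|exfalso]; lia.
  rewrite jk cover_period cover_ord /= /charge.
  by split=> [|_]; case: (ltnP j s); case: (ltnP 0 s); lia.
have const J m : cover k0 (Phi s t) J m = cover k0 (Phi s t) J 0 by [].
split=> [J m|m]; first by rewrite !(const _ m); have [] := next J.
(* The strict increase occurs from the last component, of charge at most 1, to component 0 raised by
   2. *)
exists (s + t).-1; rewrite !(const _ _.+1) (const _ m).
by have [_] := next (s + t).-1; apply; rewrite /= modn_small // prednK.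
Qed.

Lemma bounded_Phi p q : bounded p q (Phi s t).
Proof. by []. Qed.

Lemma bounded0 Y : bounded 0 0 Y -> Y = Phi s t.
Proof.
move=> bY; apply: diagrams_eq => j n; apply/eqP.
rewrite eq_le diagrams_le_charge /=; have := bY j; rewrite if_same => {1}<-.
by apply: incr_le => //; apply: diagrams_incr.
Qed.

Lemma last_column_exists Y : bounded 0 0 Y \/
  exists m j, bounded m.+1 m.+1 Y /\ Y j m <> charge s j.
Proof.
have [n] := bounded_exists Y; elim: n => [|n IH] bn; first by left.
have [|nb] := pselect (bounded n n Y); first exact: IH.
right; exists n; apply: contrapT => h; apply: nb => j; rewrite if_same.
by apply: contrapT => Yj; apply: h; exists j.
Qed.

(** Apply [last_column] at the largest width [m + 1]: the colour it makes removable is not [i], and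
    the component not yet constant in column [m] forces [m] below its own bound. *)
Lemma etilde_None_bounded i p q Y : admissible Y -> bounded p q Y ->
  etilde i Y = None ->
  bounded 0 0 Y \/ exists m,
   [/\ bounded m.+1 m Y, (m < p)%N & odd m <> odd i] \/
   [/\ bounded m m.+1 Y, (m < q)%N & odd m.+1 <> odd i].
Proof.
move=> aY bY eY; have [|[m [j [bm jm]]]] := last_column_exists Y; first by left.
right; exists m; have [[b1 [j' js jn] h]|[b1 [j' js jn] h]] := last_column aY bm jm.
  left; split=> //; last by move=> /h.
  rewrite ltnNge; apply/negP => pm; apply: jn; have := bY j'; rewrite js => e.
  have C := charge0 js; have := diagrams_le_charge Y j' m.
  by have := incr_le (@diagrams_incr _ _ Y j') pm; lia.
right; split=> //; last by move=> /h.
rewrite ltnNge; apply/negP => pm; apply: jn; have := bY j'; rewrite ltnNge js /= => e.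
have C := charge1 js; have := diagrams_le_charge Y j' m.
by have := incr_le (@diagrams_incr _ _ Y j') pm; lia.
Qed.

(* For [L = 0] the truncated bounds both vanish and only the empty tuple is left. *)
Definition bounded_walt i L Y : Prop :=
  if i == 0 then bounded L L.-1 Y else bounded L.-1 L Y.

(** The parity of [lead i L] prevents the component of largest width from attaining its bound. *)
Lemma bounded_walt_pred i L Y : admissible Y -> bounded_walt i L.+1 Y ->
  etilde (lead i L) Y = None -> bounded_walt i L Y.
Proof.
rewrite /bounded_walt => aY; have [->|i1] := ord2P i => /= bY eY.
  have [b0|[m [[b1 mL mi]|[b1 mL mi]]]] := etilde_None_bounded aY bY eY.
  - exact: bounded_le b0.
  - by rewrite odd_lead /= in mi; apply: bounded_le b1; lia.
  - by rewrite odd_lead /= in mi; apply: bounded_le b1; lia.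
rewrite i1 /= in bY eY *.
have [b0|[m [[b1 mL mi]|[b1 mL mi]]]] := etilde_None_bounded aY bY eY.
- exact: bounded_le b0.
- by rewrite odd_lead /= in mi; apply: bounded_le b1; lia.
- by rewrite odd_lead /= in mi; apply: bounded_le b1; lia.
Qed.

Lemma bounded_walt_ftilde i L Y Y' : bounded_walt i L.+1 Y ->
  ftilde (lead i L) Y = Some Y' -> bounded_walt i L.+1 Y'.
Proof.
rewrite /bounded_walt; have [->|->] := ord2P i => /=.
all: by apply: bounded_ftilde; rewrite odd_lead /=; lia.
Qed.

Lemma bounded_walt_etilde i j L Y Y' : bounded_walt i L Y ->
  etilde j Y = Some Y' -> bounded_walt i L Y'.
Proof. by rewrite /bounded_walt; case: ifP => _; apply: bounded_etilde. Qed.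

Lemma bounded_walt_succ i L Y : bounded_walt i L Y -> bounded_walt i L.+1 Y.
Proof. by rewrite /bounded_walt; case: ifP => _; apply: bounded_le; lia. Qed.

Lemma demazure_waltE i L Y :
  demazure s t (walt i L) Y <-> admissible Y /\ bounded_walt i L Y.
Proof.
elim: L Y => [|L IH] Y; split.
- move=> /demazure_walt0->; split; first exact: admissible_Phi.
  by rewrite /bounded_walt; case: ifP => _; apply: bounded_Phi.
- rewrite /bounded_walt => -[_ bY]; rewrite (@bounded0 Y); first exact: demazure_id.
  by case: ifP bY.
- move=> /demazure_waltS[b [m [/IH[ab /bounded_walt_succ bb] _]]].
  elim: m Y => [|m IHm] Y /=; first by case=> <-.
  case: (iter m _ _) IHm => //= Y1 IHm f; have [a1 b1] := IHm _ erefl.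
  by split; [apply: admissible_ftilde f|apply: bounded_walt_ftilde f].
move=> [aY bY]; pose i' := lead i L.
suff [b [m [db eb fb]]] : exists b m, [/\ demazure s t (walt i L) b,
    etilde i' b = None & iter m (obind (ftilde i')) (Some b) = Some Y].
  exact: demazure_intro db eb fb.
(* Applying [etilde] until it vanishes leads to the source [b] of the string through [Y]; the number
   of 1s decreases on the way, and [etildeK] climbs back. *)
have [n] := ubnP (count (@is_one s t) (signature i' Y)).
elim: n Y aY bY => // n IHn Y aY bY cn.
case E: (etilde i' Y) => [Y'|]; last first.
  exists Y, 0%N; split=> //; apply/IH; split=> //.
  exact: bounded_walt_pred.
have [|b [m [db eb fb]]] := IHn Y' (admissible_etilde aY E) (bounded_walt_etilde bY E).
  by apply: leq_trans (count_etilde E) _.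
by exists b, m.+1; split=> //=; rewrite fb /= (etildeK E).
Qed.

Lemma crystal_ftilde i Y Y' : crystal s t Y -> ftilde i Y = Some Y' -> crystal s t Y'.
Proof. by move=> [l h] f; exists (i :: l); rewrite /= h /=. Qed.

Lemma demazure_crystal w Y : demazure s t w Y -> crystal s t Y.
Proof.
elim=> [|i {}w b Y' m _ _ cb _]; first by exists [::].
elim: m Y' => [|m IHm] Y' /=; first by case=> <-.
by case: (iter m _ _) IHm => //= Y1 IHm; apply/crystal_ftilde/IHm.
Qed.

(** For the converse, an admissible tuple of widths at most [n] lies in the Demazure crystal of
    [walt 0 n.+1], hence is reached from the empty tuple. *)
Lemma crystalE Y : crystal s t Y <-> admissible Y.
Proof.
split=> [[l]|aY].
  elim: l Y => [|i l IH] Y /=; first by case=> <-; apply: admissible_Phi.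
  by case: (foldr _ _ _) IH => //= Y1 IH; apply/admissible_ftilde/IH.
have [n bY] := bounded_exists Y; apply: (@demazure_crystal (walt 0 n.+1)).
by apply/demazure_waltE; split=> //; apply: bounded_le bY.
Qed.

(** In each column an admissible tuple is nondecreasing in the index, so the first component of each
    charge is the widest. *)
Lemma bounded_width p q Y : admissible Y -> (bounded p q Y <->
  (forall hs : (0 < s)%N, (width (Y (lshift t (Ordinal hs))) <= p)%N) /\
  (forall ht : (0 < t)%N, (width (Y (rshift s (Ordinal ht))) <= q)%N)).
Proof.
move=> aY; split=> [bY|[h0 h1] j].
  split=> [hs|ht]; apply/width_le.
    by have := bY (lshift t (Ordinal hs)); rewrite /= hs.
  by have := bY (rshift s (Ordinal ht)); case: ltnP => //=; lia.
apply/eqP; rewrite eq_le diagrams_le_charge /=; have [js|sj] := ltnP j s.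
  have hs : (0 < s)%N by apply: leq_ltn_trans js.
  have /width_le e := h0 hs; have C := charge0 js.
  have C' : charge s (lshift t (Ordinal hs)) = 0 by apply: charge0.
  have : Y (lshift t (Ordinal hs)) p <= Y j p by apply: admissible_le.
  lia.
have ht : (0 < t)%N by have := ltn_ord j; lia.
have /width_le e := h1 ht; have C := charge1 sj.
have C' : charge s (rshift s (Ordinal ht)) = 1 by apply: charge1; rewrite /= addn0.
have : Y (rshift s (Ordinal ht)) q <= Y j q by apply: admissible_le; rewrite //= addn0.
lia.
Qed.

End Main.

Local Close Scope ring_scope.
Local Open Scope classical_set_scope.

Theorem theorem2 (s t L : nat) (hL : (0 < L)%N) :
  demazure s t (wplus L) =
    [set Y : diagrams s t | crystal s t Y
       /\ (forall hs : (0 < s)%N, (width (Y (lshift t (Ordinal hs))) <= L)%N)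
       /\ (forall ht : (0 < t)%N,
             (width (Y (rshift s (Ordinal ht))) <= L - 1)%N)]
  /\
  demazure s t (wminus L) =
    [set Y : diagrams s t | crystal s t Y
       /\ (forall hs : (0 < s)%N, (width (Y (lshift t (Ordinal hs))) <= L - 1)%N)
       /\ (forall ht : (0 < t)%N,
             (width (Y (rshift s (Ordinal ht))) <= L)%N)].
Proof.
rewrite subn1; split; apply/funext => Y; apply/propext.
  split=> [/demazure_waltE[aY /(bounded_width _ _ aY) bY]|[/crystalE aY bY]].
    by split=> //; apply/crystalE.
  by apply/demazure_waltE; split=> //; apply/bounded_width.
split=> [/demazure_waltE[aY /(bounded_width _ _ aY) bY]|[/crystalE aY bY]].
  by split=> //; apply/crystalE.
by apply/demazure_waltE; split=> //; apply/bounded_width.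
Qed.
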